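(* If $\alpha\in(0,2)$, $p\in(1,\infty)$, $s\in(0,\infty)$, and $k\in K_\alpha$, then $W_{k,p,s}$ is a critical $(k,p)$-Hardy weight.
   Context: All functions are Borel measurable; $\mathbb{R}_*:=\mathbb{R}\setminus\{0\}$; $q:=p/(p-1)$. For $\alpha\in(0,2)$, $K_\alpha$ is the set of all functions $k:\mathbb{R}^2\to[0,\infty]$ such that $k(x,y)=k(y,x)$ for all $x,y\in\mathbb{R}$; $k(rx,ry)=r^{-\alpha-1}k(x,y)$ for all $x,y\in\mathbb{R}$, $r>0$; and there is a constant $c\in(0,\infty)$ with $k(x,y)\le c|x-y|^{-\alpha-1}$ for all $x,y$. Write $a^{\langle \kappa\rangle}:=|a|^{\kappa}\operatorname{sign}(a)$, $0^{\langle \kappa\rangle}:=0$, and for $u:\mathbb{R}\to\mathbb{R}$, $$\mathcal{E}_{k,p}[u]:=\frac12\int_{\mathbb{R}}\int_{\mathbb{R}}(u(x)-u(y))\big(u(x)^{\langle p-1\rangle}-u(y)^{\langle p-1\rangle}\big)k(x,y)\,dy\,dx\in[0,\infty].$$ A function $w:\mathbb{R}\to\mathbb{R}$, locally integrable on $\mathbb{R}_*$, is a $(k,p)$-Hardy weight if $\mathcal{E}_{k,p}[u]\ge\int_{\mathbb{R}}|u(x)|^pw(x)\,dx$ for all $u\in C_c(\mathbb{R}_* )$ (continuous functions with compact support in $\mathbb{R}_*$). It is critical if moreover it cannot be increased in this inequality on any set of positive Lebesgue measure; i.e. whenever $W\ge w$ a.e. and $W$ is a $(k,p)$-Hardy weight,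 then $W=w$ a.e. (Weights need only be defined for $x\ne0$.) For $\rho\in(-1,\alpha)$, $r\in(0,\infty)$ put $$\gamma_+(k,\rho):=\int_0^1(1-t^\rho)(1-t^{\alpha-1-\rho})k(1,t)\,dt,\qquad \gamma_-(k,\rho):=\int_0^1(1-t^\rho)(1-t^{\alpha-1-\rho})k(-1,-t)\,dt,$$ $$C_+(k,r,\rho):=\gamma_+(k,\rho)+\int_0^\infty k(1,-t)\,dt-r\int_0^\infty t^\rho k(1,-t)\,dt,$$ $$C_-(k,r,\rho):=\gamma_-(k,\rho)+\int_0^\infty k(-1,t)\,dt-\frac1r\int_0^\infty t^\rho k(-1,t)\,dt ,$$ $$D_\pm(k,p,s,\beta):=\tfrac1p C_\pm\big(k,s^{1/q},\tfrac{\beta}{q}\big)+\tfrac1q C_\pm\big(k,s^{1/p},\tfrac{\beta}{p}\big),\qquad \beta\in(-p,p\alpha)\cap(-q,q\alpha).$$ Then $W_{k,p,s}(x):=|x|^{-\alpha}D_+(k,p,s,\alpha-1)$ for $x>0$ and $W_{k,p,s}(x):=|x|^{-\alpha}D_-(k,p,s,\alpha-1)$ for $x<0$. *)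

(* Defs.v *)
From HB Require Import structures.
From mathcomp Require Import all_boot all_order all_algebra.
From mathcomp Require Import all_classical all_reals all_analysis.
From mathcomp Require Import measurable_realfun.
Import Order.TTheory GRing.Theory Num.Theory.
Import numFieldNormedType.Exports.

Set Implicit Arguments.
Unset Strict Implicit.
Unset Printing Implicit Defensive.

Local Open Scope classical_set_scope.
Local Open Scope ring_scope.

(* The bound is required off the diagonal only: at x = y the right-hand side
   c * |x - y|^(-alpha-1) is +oo, whereas 0 `^ (- alpha - 1) = 0 here. *)
Record kernel_class (R : realType) (alpha : R) (k : R * R -> \bar R) : Prop :=
  KernelClass {
    kernel_measurable :
      measurable_fun [set: measurableTypeR R * measurableTypeR R] k ;
    kernel_ge0 : forall x y, (0 <= k (x, y))%E ;
    kernel_sym : forall x y, k (x, y) = k (y, x) ;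
    kernel_homogeneous : forall x y r, 0 < r ->
      k (r * x, r * y) = ((r `^ (- alpha - 1))%:E * k (x, y))%E ;
    kernel_bounded : exists2 c : R, 0 < c & forall x y, x != y ->
      (k (x, y) <= (c * `|x - y| `^ (- alpha - 1))%:E)%E
  }.

Definition spow (R : realType) (a kappa : R) : R := `|a| `^ kappa * Num.sg a.

(* On the diagonal the integrand is 0, also where k = +oo, since 0 * +oo = 0. *)
Definition energy (R : realType) (k : R * R -> \bar R) (p : R) (u : R -> R)
    : \bar R :=
  ((2^-1)%:E * \int[lebesgue_measure]_x \int[lebesgue_measure]_y
    (((u x - u y) * (spow (u x) (p - 1) - spow (u y) (p - 1)))%:E
     * k (x, y)))%E.

(* Functions in C_c(R \ {0}), extended by 0 at the origin. *)
Definition Cc_punctured (R : realType) (u : R -> R) : Prop :=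
  [/\ continuous u, compact (closure [set x | u x != 0])
    & closure [set x | u x != 0] `<=` [set~ 0]].

(* The value w 0 is irrelevant. *)
Definition Hardy_weight (R : realType) (k : R * R -> \bar R) (p : R)
    (w : R -> R) : Prop :=
  locally_integrable [set~ 0] w /\
  forall u : R -> R, Cc_punctured u ->
    (\int[lebesgue_measure]_x (`|u x| `^ p * w x)%:E <= energy k p u)%E.

Definition critical_Hardy_weight (R : realType) (k : R * R -> \bar R) (p : R)
    (w : R -> R) : Prop :=
  Hardy_weight k p w /\
  forall W : R -> R, Hardy_weight k p W ->
    {ae lebesgue_measure, forall x : R, w x <= W x} ->
    {ae lebesgue_measure, forall x : R, W x = w x}.

(* For k in kernel_class alpha with 0 < alpha < 2 and -1 < rho < alpha, the
   integrals below converge absolutely, so that fine is the identity on them. *)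
Section Constants.
Context {R : realType}.
Implicit Types (alpha rho r p s beta : R) (k : R * R -> \bar R).

Definition gamma_pos alpha k rho : R :=
  fine (\int[lebesgue_measure]_(t in `]0%R, 1%R[)
    (((1 - t `^ rho) * (1 - t `^ (alpha - 1 - rho)))%:E * k (1, t)%R))%E.

Definition gamma_neg alpha k rho : R :=
  fine (\int[lebesgue_measure]_(t in `]0%R, 1%R[)
    (((1 - t `^ rho) * (1 - t `^ (alpha - 1 - rho)))%:E * k (- 1, - t)%R))%E.

Definition C_pos alpha k r rho : R :=
  gamma_pos alpha k rho
  + fine (\int[lebesgue_measure]_(t in `]0%R, +oo[) k (1, - t)%R)%E
  - r * fine (\int[lebesgue_measure]_(t in `]0%R, +oo[)
                ((t `^ rho)%:E * k (1, - t)%R))%E.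

Definition C_neg alpha k r rho : R :=
  gamma_neg alpha k rho
  + fine (\int[lebesgue_measure]_(t in `]0%R, +oo[) k (- 1, t)%R)%E
  - r^-1 * fine (\int[lebesgue_measure]_(t in `]0%R, +oo[)
                   ((t `^ rho)%:E * k (- 1, t)%R))%E.

Definition conj_exp p : R := p / (p - 1).

Definition D_pos alpha k p s beta : R :=
  let q := conj_exp p in
  p^-1 * C_pos alpha k (s `^ q^-1) (beta / q)
  + q^-1 * C_pos alpha k (s `^ p^-1) (beta / p).

Definition D_neg alpha k p s beta : R :=
  let q := conj_exp p in
  p^-1 * C_neg alpha k (s `^ q^-1) (beta / q)
  + q^-1 * C_neg alpha k (s `^ p^-1) (beta / p).

(* The value at x = 0 is arbitrary. *)
Definition weight alpha k p s (x : R) : R :=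
  if 0 < x then `|x| `^ (- alpha) * D_pos alpha k p s (alpha - 1)
  else if x < 0 then `|x| `^ (- alpha) * D_neg alpha k p s (alpha - 1)
  else 0.

End Constants.

(* Main.v *)
From HB Require Import structures.
Require Import Defs.
From mathcomp Require Import all_boot all_order all_algebra.
From mathcomp Require Import all_classical all_reals all_analysis.
From mathcomp Require Import measurable_realfun.
From mathcomp Require Import ring lra.
Set Implicit Arguments.
Unset Strict Implicit.
Unset Printing Implicit Defensive.
Import Order.TTheory GRing.Theory Num.Theory.
Import numFieldNormedType.Exports.
Local Open Scope classical_set_scope.
Local Open Scope ring_scope.

(* In logarithmic coordinates x = e^z, y = e^(z+a) (on each pair of half-lines)
   the energy is an integral over a and z of a weighted energy gap of u against
   a kernel in a alone.  Comparing u with the ground state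
   h(x) = c |x|^((alpha-1)/p), whose constants on the two half-lines have ratio
   s^(1/p), Young's inequality with weight h(y)/h(x) bounds the energy gap below
   by a combination of |u(x)|^p and |u(y)|^p, with equality for u = h.
   Integrating the coefficients against the kernel gives exactly D_+ and D_-,
   hence the Hardy inequality.  For criticality, test with h * f^q, where
   f(x) = max(0, 1 - |log |x|| / N): the defect in Young's inequality is at most
   a constant times h^p (f(x) - f(y))^2, and its integral is O(1/N).  As these
   test functions increase with N, a larger Hardy weight must coincide with W. *)

(** On one half-line the two Young coefficients cannot in general be integrated separately: the
    kernel may blow up like [|a|^(-alpha-1)] at [a = 0], while each coefficient vanishes there only
    to first order. Therefore [a] is frozen and [z] is integrated out before [a]: translation
    invariance puts the same mass in front of both coefficients, and their sum factors as
    [diag_weight], which vanishes to second order, enough since [alpha < 2]. This is the origin of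
    the product in [gamma_pos] and [gamma_neg]. Across the origin the kernel stays bounded near
    [a = 0], and the terms are integrated one by one. For large [|a|] the exponentials grow at most
    like [e^(|alpha-1| |a| / 2)] against a kernel of size [e^(-(alpha+1) |a| / 2)], which leaves the
    decay [e^(-min(1,alpha) |a|)]. The lower bound changes sign, so Tonelli is used for the energy
    only. The power [q] on the cutoff [f] makes both [f^q] and [(f^q)^(p-1) = f^p] Lipschitz for
    every [p > 1]. A squared slope [1/N^2] on a window of length of order [N] yields [O(1/N)]. *)

Definition density_measure d (T : measurableType d) (R : realType)
    (mu : {measure set T -> \bar R}) (w : T -> R) : set T -> \bar R :=
  fun A => (\int[mu]_(x in A) (w x)%:E)%E.

(** * Integration against a measure with density *)

Section density_measure.
Context d (T : measurableType d) (R : realType) (mu : {measure set T -> \bar R}).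
Variables (w : T -> R) (mw : measurable_fun setT w) (w0 : forall x, 0 <= w x).
Local Open Scope ereal_scope.

Lemma density_measure0 : density_measure mu w set0 = 0.
Proof. exact: integral_set0. Qed.

Lemma density_measure_ge0 A : 0 <= density_measure mu w A.
Proof. by apply: integral_ge0 => x _; rewrite lee_fin. Qed.

Lemma density_measure_sigma_additive :
  semi_sigma_additive (density_measure mu w).
Proof.
move=> F mF tF mUF; rewrite /density_measure ge0_integral_bigcup//=.
- by apply: is_cvg_ereal_nneg_natsum => n _; exact: density_measure_ge0.
- by apply/measurable_EFinP; exact: measurable_funTS.
- by move=> x _; rewrite lee_fin.
Qed.

Definition density_mixin of measurable_fun setT w & (forall x, (0 <= w x)%R) :=
  isMeasure.Build _ T R (density_measure mu w) density_measure0
  density_measure_ge0 density_measure_sigma_additive.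

Definition density : {measure set T -> \bar R} :=
  HB.pack (density_measure mu w) (density_mixin mw w0).

Import HBNNSimple.

(** By monotone convergence both sides are limits along simple functions increasing to [f], and for
    a simple function they agree level set by level set. *)
Lemma ge0_integral_density (f : T -> \bar R) : measurable_fun setT f ->
  (forall x, 0 <= f x) ->
  \int[density]_x f x = \int[mu]_x (f x * (w x)%:E).
Proof.
move=> mf f0.
have mfw : measurable_fun setT (EFin \o w) by apply/measurable_EFinP.
pose h := nnsfun_approx measurableT mf.
have -> : \int[density]_x f x = limn (fun n => \int[density]_x (h n x)%:E).
  rewrite -monotone_convergence//.
  - apply: eq_integral => x _; apply/esym/cvg_lim => //.
    exact: cvg_nnsfun_approx.
  - by move=> n; exact/measurable_EFinP/measurable_funP.
  - by move=> n x _; rewrite lee_fin.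
  - by move=> x _ m n mn; rewrite lee_fin; exact/lefP/nd_nnsfun_approx.
have -> : \int[mu]_x (f x * (w x)%:E) =
    limn (fun n => \int[mu]_x ((h n x)%:E * (w x)%:E)).
  rewrite -monotone_convergence//.
  - apply: eq_integral => x _; apply/esym/cvg_lim => //.
    by apply: cvgeZr => //; exact: cvg_nnsfun_approx.
  - move=> n; apply: emeasurable_funM => //.
    exact/measurable_EFinP/measurable_funP.
  - by move=> n x _; rewrite mule_ge0// lee_fin.
  - move=> x _ m n mn; rewrite lee_wpmul2r ?lee_fin//.
    exact/lefP/nd_nnsfun_approx.
congr (limn _); apply/funext => n.
have mh r : measurable (h n @^-1` [set r]) by [].
have indic0 r x : 0 <= (r * \1_(h n @^-1` [set r]) x)%:E.
  by rewrite EFinM; exact: nnfun_muleindic_ge0.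
under eq_integral do rewrite fimfunE -fsumEFin//.
rewrite ge0_integral_fsum//; last first.
  by move=> r; exact/measurable_EFinP/measurable_funM.
under [RHS]eq_integral => x _.
  rewrite fimfunE -fsumEFin// ge0_mule_fsuml; last by move=> r; exact: indic0.
  over.
rewrite ge0_integral_fsum//; last 2 first.
- move=> r; apply: emeasurable_funM => //.
  exact/measurable_EFinP/measurable_funM.
- by move=> r x _; apply: mule_ge0; [exact: indic0|rewrite lee_fin].
apply: eq_fsbigr => r rhn.
have r0 : (0 <= r)%R by move: rhn; rewrite inE => -[t _ <-].
under eq_integral do rewrite EFinM.
rewrite integralZl_indic_nnsfun// integral_indic// setIT.
under [RHS]eq_integral do rewrite EFinM -muleA.
rewrite ge0_integralZl//; last 2 first.
- apply: emeasurable_funM => //; exact/measurable_EFinP.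
- by move=> x _; rewrite mule_ge0 ?lee_fin.
congr (_ * _); rewrite /= /density_measure integral_mkcond.
apply: eq_integral => x _; rewrite /= epatch_indic muleC//.
Qed.

End density_measure.

(** * Substitution [x = e^z], reflection and translation for Lebesgue integrals *)

Section exponential_substitution.
Context {R : realType}.
Local Notation mu := (@lebesgue_measure R).

Let expR_right_continuous : right_continuous (@expR R).
Proof. by move=> x; apply: cvg_at_right_filter; exact: continuous_expR. Qed.

Let expR_nd : {homo (@expR R) : x y / x <= y}.
Proof. by move=> x y xy; rewrite ler_expR. Qed.

Let exp_mixin := isCumulative.Build R _ R _ expR_nd expR_right_continuous.
Let cumulative_expR : cumulative R R := HB.pack (@expR R) exp_mixin.

Let mln : measurable_fun [set: measurableTypeR R]
  (@ln R : measurableTypeR R -> measurableTypeR R).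
Proof. exact: measurable_ln. Qed.

Let mexp : measurable_fun [set: measurableTypeR R]
  (@expR R : measurableTypeR R -> R).
Proof. exact: measurable_expR. Qed.

Local Open Scope ereal_scope.

Let mpos : measurable (`]0%R, +oo[%classic : set (measurableTypeR R)).
Proof. exact: measurable_itv. Qed.

(** The image under [ln] of Lebesgue measure on the positive half-line; restricting beforehand
    removes the points where [ln] takes a default value. *)
Let lnmu : {measure set (measurableTypeR R) -> \bar R} :=
  measure_function_pushforward__canonical__measure_function_Measure
   (mrestr mu mpos) mln.

Lemma integral_expR_itv (a b : R) : (a < b)%R ->
  \int[mu]_(z in `]a, b]) (expR z)%:E = (expR b - expR a)%:E.
Proof.
move=> ab.
rewrite integral_itv_obnd_cbnd; last first.
  by apply/measurable_EFinP; apply: measurable_funTS; exact: measurable_expR.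
rewrite (@continuous_FTC2 _ expR expR)//.
- by apply: continuous_subspaceT; exact: continuous_expR.
- split; first by move=> x _; exact: derivable_expR.
  + by apply: cvg_at_right_filter; exact: continuous_expR.
  + by apply: cvg_at_left_filter; exact: continuous_expR.
- by move=> x _; rewrite derive1E derive_val.
Qed.

Let density_exp : {measure set (measurableTypeR R) -> \bar R} :=
  density mu mexp (@expR_ge0 R).

Let lnmu_itv a b : (a < b)%R -> lnmu `]a, b]%classic = (expR b - expR a)%:E.
Proof.
move=> ab; rewrite /lnmu /= /pushforward /mrestr /=.
rewrite (_ : _ `&` _ = `]expR a, expR b]%classic); last first.
  apply/seteqP; split => x /=; rewrite !in_itv/= ?andbT.
    move=> [/andP[ax xb] x0]; rewrite -[x]lnK ?posrE//.
    by rewrite ltr_expR ler_expR ax.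
  move=> /andP[ax xb]; have x0 : (0 < x)%R by rewrite (lt_trans _ ax) ?expR_gt0.
  by move: ax xb; rewrite -{1 2}[x]lnK ?posrE// ltr_expR ler_expR => -> ->.
by rewrite lebesgue_measure_itv/= lte_fin ltr_expR ab EFinB.
Qed.

(** Both measures give []a, b]] the mass [expR b - expR a], so each is the Lebesgue-Stieltjes
    measure of [expR]. *)
Let lnmuE A : measurable A -> lnmu A = density_exp A.
Proof.
have itvE X (m : {measure set (measurableTypeR R) -> \bar R}) : ocitv X ->
    (forall a b, (a < b)%R -> m `]a, b]%classic = (expR b - expR a)%:E) ->
    lebesgue_stieltjes_measure cumulative_expR X = m X.
  move=> [[a b] _ <-] mE /=.
  have [ab|ba] := ltP a b; last by rewrite set_itv_ge ?measure0//= bnd_simp -leNgt.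
  transitivity (wlength cumulative_expR `]a, b]%classic).
    by apply: (measurable_mu_extE (wlength cumulative_expR)); exact: is_ocitv.
  by rewrite mE// wlength_itv_bnd// ltW.
move=> mA.
transitivity (lebesgue_stieltjes_measure cumulative_expR A).
  apply/esym/lebesgue_stieltjes_measure_unique => [X oX|//].
  exact: (itvE X lnmu oX lnmu_itv).
apply: lebesgue_stieltjes_measure_unique => [X oX|//].
exact: (itvE X density_exp oX integral_expR_itv).
Qed.

Lemma ge0_integral_expR (f : R -> \bar R) :
  measurable_fun setT f -> (forall x, 0 <= f x) ->
  \int[mu]_(x in `]0%R, +oo[) f x = \int[mu]_z (f (expR z) * (expR z)%:E).
Proof.
move=> mf f0.
have mfexp : measurable_fun setT (f \o @expR R).
  by apply: measurableT_comp => //; exact: measurable_expR.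
transitivity (\int[density_exp]_z f (expR z)); last first.
  by rewrite (ge0_integral_density mu mexp (@expR_ge0 R) mfexp) => [|x]; rewrite ?f0.
rewrite -(@eq_measure_integral _ _ _ setT density_exp lnmu); last first.
  by move=> A mA _; exact: lnmuE.
rewrite /lnmu ge0_integral_pushforward// preimage_setT.
(* Off the positive half-line [expR (ln x)] differs from [x], but the restricted measure vanishes
   there. *)
rewrite -(setUv (`]0%R, +oo[%classic : set (measurableTypeR R))).
have mfl : measurable_fun [set: measurableTypeR R] ((f \o expR) \o @ln R).
  exact: measurableT_comp.
rewrite ge0_integral_setU//=; last 3 first.
- exact: measurableC.
- by rewrite setUv.
- exact/disj_setPCl.
rewrite [X in _ + X](@eq_measure_integral _ _ _ _ mzero); last first.
  by move=> A mA AC; rewrite /= /mrestr (_ : _ `&` _ = set0) ?measure0//;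
    apply/disjoints_subset.
rewrite integral_measure_zero adde0.
rewrite [RHS](@eq_measure_integral _ _ _ _ mu); last first.
  by move=> A mA AD; rewrite /= /mrestr setIidl.
apply: eq_integral => x; rewrite inE/= in_itv/= andbT => x0.
by rewrite lnK.
Qed.

Lemma ge0_integralN (f : R -> \bar R) :
  measurable_fun setT f -> (forall x, 0 <= f x) ->
  \int[mu]_x f (- x)%R = \int[mu]_x f x.
Proof.
move=> mf f0.
have mN : measurable_fun [set: measurableTypeR R]
  (-%R : measurableTypeR R -> measurableTypeR R) by exact: oppr_measurable.
rewrite [RHS](@eq_measure_integral _ _ _ _
  (measure_function_pushforward__canonical__measure_function_Measure mu mN)).
  by rewrite ge0_integral_pushforward.
by move=> A mA _; exact/esym/lebesgue_measureN.
Qed.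

Lemma ge0_integral_translate (c : R) (f : R -> \bar R) :
  measurable_fun setT f -> (forall x, 0 <= f x) ->
  \int[mu]_x f (c + x)%R = \int[mu]_x f x.
Proof.
move=> mf f0.
have mN : measurable_fun [set: measurableTypeR R]
  (+%R c : measurableTypeR R -> measurableTypeR R).
  by apply: measurable_funD.
pose nu := measure_function_pushforward__canonical__measure_function_Measure mu mN.
rewrite [RHS](@eq_measure_integral _ _ _ _ nu).
  by rewrite ge0_integral_pushforward.
move=> A mA _; apply: lebesgue_measure_unique => // _ [[a b]] _ <-.
rewrite /= /pushforward (_ : _ @^-1` _ = `](a - c)%R, (b - c)%R]%classic).
  rewrite !lebesgue_measure_itv/= !lte_fin ltrD2r; case: ifP => // _.
  by rewrite -!EFinB; congr EFin; ring.
by apply/seteqP; split => x /=; rewrite !in_itv/= ltrBlDl lerBrDl.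
Qed.

Lemma ge0_integral_expR_sum (f : R -> \bar R) :
  measurable_fun setT f -> (forall x, 0 <= f x) ->
  \int[mu]_x f x = \int[mu]_z (f (expR z) * (expR z)%:E) +
                   \int[mu]_z (f (- expR z)%R * (expR z)%:E).
Proof.
move=> mf f0.
have mfN : measurable_fun setT (f \o -%R).
  by apply: measurableT_comp => //; exact: oppr_measurable.
rewrite -ge0_integral_expR// -(@ge0_integral_expR (f \o -%R))//; last by move=> x; exact: f0.
rewrite -(setUv `[0%R, +oo[%classic) ge0_integral_setU//=; last 3 first.
- exact: measurableC.
- by rewrite setUv.
- exact/disj_setPCl.
(* The origin has measure zero and may be attached to either half-line. *)
rewrite integral_itv_obnd_cbnd; last exact: measurable_funTS.
congr (_ + _).
rewrite integral_itv_obnd_cbnd; last exact: measurable_funTS.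
rewrite ge0_integration_by_substitution0//.
under [RHS]eq_integral do rewrite /= opprK.
rewrite -integral_itv_bndo_bndc; last exact: measurable_funTS.
by rewrite setCitvr.
Qed.

End exponential_substitution.

Lemma eq_ler (R : realDomainType) (x y : R) : x = y -> x <= y.
Proof. by move=> ->. Qed.

(** * Signed powers and two-sided bounds for the energy gap *)

Definition energy_gap (R : realType) (p b d : R) : R :=
  (b - d) * (spow b (p - 1) - spow d (p - 1)).

Section signed_power.
Context {R : realType}.
Implicit Types (a b d e kappa p lam : R).

Lemma ge0_spow a kappa : 0 <= a -> 0 < kappa -> spow a kappa = a `^ kappa.
Proof.
rewrite /spow le_eqVlt => /predU1P[<- k0|a0 k0].
  by rewrite sgr0 mulr0 powR0// gt_eqF.
by rewrite gtr0_sg// mulr1 gtr0_norm.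
Qed.

Lemma spowN a kappa : spow (- a) kappa = - spow a kappa.
Proof. by rewrite /spow normrN sgrN mulrN. Qed.

Lemma norm_spow a kappa : 0 < kappa -> `|spow a kappa| = `|a| `^ kappa.
Proof.
move=> k0; rewrite /spow normrM normr_sg ger0_norm ?powR_ge0//.
by have [->|_] := eqVneq a 0; rewrite ?mulr1// normr0 powR0 ?gt_eqF// mul0r.
Qed.

Lemma spowM lam a kappa : 0 < lam ->
  spow (lam * a) kappa = lam `^ kappa * spow a kappa.
Proof.
move=> l0; rewrite /spow normrM sgrM gtr0_sg// mul1r gtr0_norm//.
by rewrite powRM ?(ltW l0)// mulrA.
Qed.

Lemma ler_spow a b kappa : 0 < kappa -> a <= b -> spow a kappa <= spow b kappa.
Proof.
move=> k0 ab; have [a0|a0] := leP 0 a.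
  have b0 := le_trans a0 ab.
  by rewrite !ge0_spow// ge0_ler_powR ?nnegrE// ltW.
have [b0|b0] := leP 0 b.
  rewrite (ge0_spow b0)// (le_trans _ (powR_ge0 _ _))//.
  by rewrite -[a]opprK spowN oppr_le0 ge0_spow ?powR_ge0// oppr_ge0 ltW.
rewrite -[a]opprK -[b]opprK !(spowN (- _)) lerN2 !ge0_spow ?oppr_ge0 ?(ltW a0) ?(ltW b0)//.
by rewrite ge0_ler_powR ?nnegrE ?oppr_ge0 ?lerN2 ?(ltW a0) ?(ltW b0) ?(ltW k0).
Qed.

Lemma measurable_spow kappa :
  measurable_fun setT (fun a : R => spow a kappa).
Proof.
apply: measurable_funM.
  apply: (measurableT_comp (measurable_powR kappa)).
  exact: normr_measurable.
rewrite (_ : @Num.sg R =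
    fun a => if 0 < a then 1 else if a < 0 then -1 else 0); last first.
  apply/funext => a; case: (sgrP a) => //.
by do 2 (apply: measurable_fun_ifT => //; first exact: measurable_fun_ltr).
Qed.

Lemma mulr_spow p a : 1 < p -> a * spow a (p - 1) = `|a| `^ p.
Proof.
move=> p1; rewrite /spow mulrCA.
have -> : a * Num.sg a = `|a|.
  rewrite {1}[a]numEsg mulrAC -expr2 sqr_sg.
  by case: eqVneq => [->|_]; rewrite ?normr0 ?mulr0 // mul1r.
by rewrite mulrC mulr_powRB1// (lt_trans _ p1).
Qed.

Lemma energy_gap_ge0 p b d : 1 < p -> 0 <= energy_gap p b d.
Proof.
move=> p1; rewrite /energy_gap; have p10 : 0 < p - 1 by rewrite subr_gt0.
have [bd|/ltW db] := leP b d.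
  by rewrite mulr_le0// subr_le0// ler_spow.
by rewrite mulr_ge0// subr_ge0// ler_spow.
Qed.

Lemma energy_gapE p b d : 1 < p -> energy_gap p b d =
  `|b| `^ p + `|d| `^ p - b * spow d (p - 1) - d * spow b (p - 1).
Proof.
by move=> p1; rewrite /energy_gap mulrBl !mulrBr !mulr_spow//; ring.
Qed.

Lemma powR_conj_exp p d : 1 < p -> 0 <= d ->
  (d `^ (p - 1)) `^ conj_exp p = d `^ p.
Proof.
by move=> p1 d0; rewrite -powRrM /conj_exp mulrC divfK// subr_eq0 gt_eqF.
Qed.

Lemma conj_exp_gt1 p : 1 < p -> 1 < conj_exp p.
Proof.
by move=> p1; rewrite /conj_exp ltr_pdivlMr ?mul1r ?gtrBl// subr_gt0.
Qed.

Lemma conj_expE p : 1 < p -> p^-1 + (conj_exp p)^-1 = 1.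
Proof.
move=> p1; rewrite /conj_exp invfM invrK.
by field; rewrite gt_eqF// (lt_trans _ p1).
Qed.

Lemma young_spow p b d : 1 < p ->
  b * spow d (p - 1) <= p^-1 * `|b| `^ p + (conj_exp p)^-1 * `|d| `^ p.
Proof.
move=> p1; apply: (le_trans (ler_norm _)); rewrite normrM norm_spow ?subr_gt0//.
rewrite ![_^-1 * _]mulrC -(@powR_conj_exp p `|d|)//.
apply: conjugate_powR; rewrite ?powR_ge0 ?conj_expE//.
  by rewrite (lt_trans _ p1).
by rewrite (lt_trans _ (conj_exp_gt1 p1)).
Qed.

(* The coefficient of [`|b| `^ p] in the lower bound [energy_gap_ge], which is
   attained at [d = lam * b]. *)
Definition young_weight p lam : R :=
  1 - p^-1 * lam `^ (p - 1) - (conj_exp p)^-1 * lam.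

(** Young's inequality for [lam * b] and [d], divided by [lam]. The free parameter moves the
    equality case from [d = b] to [d = lam * b]. *)
Lemma young_spow_weighted p lam b d : 1 < p -> 0 < lam ->
  b * spow d (p - 1) <= p^-1 * lam `^ (p - 1) * `|b| `^ p
                        + (conj_exp p)^-1 * lam^-1 * `|d| `^ p.
Proof.
move=> p1 l0; have := young_spow (lam * b) d p1.
rewrite normrM (gtr0_norm l0) powRM ?(ltW l0)//.
rewrite -(@mulr_powRB1 _ lam p) ?(ltW l0) ?(lt_trans _ p1)// => h.
rewrite -(@ler_pM2l _ lam)//.
apply: (le_trans _ (le_trans h _)); first by rewrite mulrA.
rewrite mulrDr (_ : lam * (_ / _ * _) = (conj_exp p)^-1 * `|d| `^ p).
  by apply: eq_ler; ring.
by field; rewrite (gt_eqF l0) gt_eqF// (lt_trans _ (conj_exp_gt1 p1)).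
Qed.

(** The two mixed products of the expanded gap are bounded by weighted Young, with parameter [lam]
    for one and [lam^-1] for the other, so that both are sharp at the same [d = lam * b]. *)
Lemma energy_gap_ge p lam b d : 1 < p -> 0 < lam ->
  `|b| `^ p * young_weight p lam + `|d| `^ p * young_weight p lam^-1
  <= energy_gap p b d.
Proof.
move=> p1 l0; rewrite energy_gapE//.
have h1 := young_spow_weighted b d p1 l0.
have li0 : 0 < lam^-1 by rewrite invr_gt0.
have h2 := young_spow_weighted d b p1 li0.
rewrite /young_weight; rewrite invrK in h2; lra.
Qed.

(** Young's inequality for [b * a^(p-1)] replaces the mean value theorem: it gives
    [a^p - b^p <= p * (a - b) * a^(p-1)], and [a^(p-1) <= 1]. *)
Lemma powR_sub_le p a b : 1 < p -> 0 <= a <= 1 -> 0 <= b <= a ->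
  a `^ p - b `^ p <= p * (a - b).
Proof.
move=> p1 /andP[a0 a1] /andP[b0 ba].
have := young_spow b a p1; rewrite ge0_spow ?subr_gt0// !ger0_norm//.
have p0 : 0 < p by rewrite (lt_trans _ p1).
rewrite -(mulr_powRB1 a0 p0).
have -> : (conj_exp p)^-1 = 1 - p^-1 by rewrite -(conj_expE p1); ring.
set y := a `^ (p - 1); have y0 : 0 <= y by exact: powR_ge0.
have y1 : y <= 1.
  have <- : 1 `^ (p - 1) = 1 :> R by rewrite powR1.
  by rewrite ge0_ler_powR ?nnegrE// subr_ge0 ltW.
move=> h; have : p * (b * y) <= b `^ p + (p - 1) * (a * y).
  rewrite -(ler_pM2l p0) in h; apply: (le_trans h).
  by apply: eq_ler; field; rewrite gt_eqF.
have : (a - b) * y <= a - b by rewrite ler_piMr// subr_ge0.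
move=> h1 h2; have : p * ((a - b) * y) <= p * (a - b) by rewrite ler_pM2l.
lra.
Qed.

Lemma powR_lipschitz p a b : 1 < p -> 0 <= a <= 1 -> 0 <= b <= 1 ->
  `|a `^ p - b `^ p| <= p * `|a - b|.
Proof.
move=> p1 /andP[a0 a1] /andP[b0 b1].
wlog ba : a b a0 a1 b0 b1 / b <= a.
  have [ba|/ltW ab] := leP b a; first exact.
  by rewrite distrC (distrC a); exact.
rewrite !ger0_norm ?subr_ge0//; last first.
  by rewrite ge0_ler_powR ?nnegrE// ltW// (lt_trans _ p1).
by apply: powR_sub_le; rewrite ?a0 ?b0.
Qed.

(** Since [q * (p - 1) = p], the two factors of the gap are increments of [t^q] and [t^p], with
    Lipschitz constants [q] and [p] on the unit interval. *)
Lemma energy_gap_powR_le p a b : 1 < p -> 0 <= a <= 1 -> 0 <= b <= 1 ->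
  energy_gap p (a `^ conj_exp p) (b `^ conj_exp p)
  <= p * conj_exp p * (a - b) ^+ 2.
Proof.
move=> p1 ha hb; apply: (le_trans (ler_norm _)).
rewrite /energy_gap !ge0_spow ?powR_ge0 ?subr_gt0// normrM -!powRrM.
have -> : conj_exp p * (p - 1) = p by rewrite /conj_exp divfK// subr_eq0 gt_eqF.
have h1 := powR_lipschitz (conj_exp_gt1 p1) ha hb.
have h2 := powR_lipschitz p1 ha hb.
rewrite -real_normK ?num_real// expr2 mulrACA.
by rewrite [leLHS]mulrC; apply: ler_pM.
Qed.

(** The reverse of [energy_gap_ge] up to an error. With the ground state factored out, the loss in
    the two weighted Young inequalities is [h^p] times a combination, with coefficients [lam^(p-1)]
    and [lam], of the losses in the unweighted ones for [x] and [y]. *)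
Lemma energy_gap_le p lam h a b : 1 < p -> 0 < lam -> 0 < h ->
  0 <= a <= 1 -> 0 <= b <= 1 ->
  energy_gap p (h * a `^ conj_exp p) (h * lam * b `^ conj_exp p) <=
  `|h * a `^ conj_exp p| `^ p * young_weight p lam
  + `|h * lam * b `^ conj_exp p| `^ p * young_weight p lam^-1
  + h `^ p * (lam `^ (p - 1) + lam) * (p * conj_exp p * (a - b) ^+ 2).
Proof.
move=> p1 l0 h0 ha hb; have hl0 : 0 < h * lam by rewrite mulr_gt0.
have p0 : 0 < p by rewrite (lt_trans _ p1).
have := energy_gap_powR_le p1 ha hb.
set x := a `^ _; set y := b `^ _; set E := p * conj_exp p * _ => hE.
rewrite !energy_gapE// in hE *; rewrite !spowM//.
rewrite !(normrM h) !(normrM (h * lam)) (gtr0_norm h0) (gtr0_norm hl0).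
have hV : lam^-1 `^ (p - 1) = (lam `^ (p - 1))^-1.
  by rewrite -(powR_inv1 (ltW l0)) -(powR_inv1 (powR_ge0 lam (p - 1))) powRAC.
rewrite !powRM ?powR_ge0 ?(ltW h0) ?(ltW l0) ?(ltW hl0)// /young_weight hV.
rewrite -(mulr_powRB1 (ltW h0) p0) -(mulr_powRB1 (ltW l0) p0).
set H := h `^ (p - 1); set L := lam `^ (p - 1).
have L0 : 0 < L by exact: powR_gt0.
have H0 : 0 < H by exact: powR_gt0.
have hq : (conj_exp p)^-1 = 1 - p^-1 by rewrite -(conj_expE p1); ring.
have y1 := young_spow x y p1; have y2 := young_spow y x p1.
rewrite hq in y1 y2 *.
set X := `|x| `^ p in hE y1 y2 *; set Y := `|y| `^ p in hE y1 y2 *.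
set XY := x * spow y (p - 1) in hE y1 y2 *; set YX := y * spow x (p - 1) in hE y1 y2 *.
(* The two unweighted losses are nonnegative and add up to the gap of [x] and [y], so each of them
   alone is at most [E]. *)
have e1 : p^-1 * X + (1 - p^-1) * Y - XY <= E by lra.
have e2 : p^-1 * Y + (1 - p^-1) * X - YX <= E by lra.
have -> : h * x * (H * L * spow y (p - 1)) = h * H * L * XY by rewrite /XY; ring.
have -> : h * lam * y * (H * spow x (p - 1)) = h * H * lam * YX by rewrite /YX; ring.
have hH0 : 0 < h * H by rewrite mulr_gt0.
have e3 := ler_wpM2l (ltW (mulr_gt0 hH0 L0)) e1.
have e4 := ler_wpM2l (ltW (mulr_gt0 hH0 l0)) e2.
have := lerD e3 e4; rewrite -(lerD2r (h * H * X * (1 - p^-1 * L - (1 - p^-1) * lam) + h * H * lam * L * Y *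
   (1 - p^-1 / L - (1 - p^-1) / lam))) => e5.
apply: (le_trans (le_trans _ e5)); apply: eq_ler; field; rewrite ?gt_eqF//.
Qed.

End signed_power.

(** * An integrable majorant with a power singularity and exponential decay *)

Section kernel_majorant.
Context {R : realType}.
Local Notation mu := (@lebesgue_measure R).
Implicit Types (alpha eta theta nu x z : R).

Lemma integral_expRN_norm_lty eta : 0 < eta ->
  (\int[mu]_z (expR (- (eta * `|z|)))%:E < +oo)%E.
Proof.
move=> eta0.
have me : measurable_fun setT (exponential_pdf eta) by exact: measurable_exponential_pdf.
have e0 x : 0 <= exponential_pdf eta x by apply: exponential_pdf_ge0; exact: ltW.
have mE : measurable_fun setT (EFin \o exponential_pdf eta) by exact/measurable_EFinP.
have mEN : measurable_fun setT ((EFin \o exponential_pdf eta) \o -%R).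
  by apply: measurableT_comp => //; exact: oppr_measurable.
have e1 : (\int[mu]_z (exponential_pdf eta z)%:E = 1)%E by exact: integral_exponential_pdf.
have e2 : (\int[mu]_z (exponential_pdf eta (- z))%:E = 1)%E.
  by rewrite -e1 (ge0_integralN mE)// => x; rewrite lee_fin.
apply: (@le_lt_trans _ _ (\int[mu]_z (eta^-1%:E *
    ((exponential_pdf eta z)%:E + (exponential_pdf eta (- z))%:E)))%E).
  apply: ge0_le_integral => //=.
  - apply/measurable_EFinP; apply: measurableT_comp => //.
    apply: measurableT_comp => //; apply: measurable_funM => //.
  - by apply: measurable_funeM; exact: emeasurable_funD.
  - move=> z _; rewrite -EFinD -EFinM lee_fin.
    rewrite mulrDr; have [z0|z0] := leP 0 z.
      rewrite (exponential_pdfE _ z0) mulrA mulVf ?gt_eqF// mul1r.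
      by rewrite ger0_norm// mulNr lerDl mulr_ge0// invr_ge0 ltW.
    rewrite (@exponential_pdfE _ _ (- z)) ?oppr_ge0 ?(ltW z0)//.
    rewrite [X in _ + X]mulrA mulVf ?gt_eqF// mul1r.
    by rewrite ltr0_norm// mulNr lerDr mulr_ge0// invr_ge0 ltW.
rewrite ge0_integralZl//=; last 3 first.
- exact: emeasurable_funD.
- by move=> x _; rewrite adde_ge0 ?lee_fin.
- by rewrite lee_fin invr_ge0 ltW.
rewrite ge0_integralD//=; last 2 first.
- by move=> x _; rewrite lee_fin.
- by move=> x _; rewrite lee_fin.
by rewrite e1 e2 -EFinD -EFinM ltry.
Qed.

(** Under [x = e^z] the singularity at 0 becomes decay of rate [1 - theta] at minus infinity, so one
    two-sided exponential dominates both ends. *)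
Lemma integral_powR_expRN_lty theta nu : 0 <= theta < 1 -> 0 < nu ->
  (\int[mu]_x (`|x| `^ (- theta) * expR (- (nu * `|x|)))%:E < +oo)%E.
Proof.
move=> /andP[t0 t1] nu0; set f := fun x : R => (_%:E).
have mf : measurable_fun setT f.
  apply/measurable_EFinP; apply: measurable_funM.
    by apply: (measurableT_comp (measurable_powR (- theta))); exact: normr_measurable.
  apply: measurableT_comp => //; apply: measurableT_comp => //.
  by apply: measurable_funM => //.
have f0 x : (0 <= f x)%E by rewrite lee_fin mulr_ge0 ?powR_ge0 ?expR_ge0.
rewrite (ge0_integral_expR_sum mf)//.
have -> : (\int[mu]_z (f (- expR z)%R * (expR z)%:E) = \int[mu]_z (f (expR z) * (expR z)%:E))%E.
  by apply: eq_integral => z _; rewrite /f normrN.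
suff h : (\int[mu]_z (f (expR z) * (expR z)%:E) < +oo)%E by rewrite lte_add_pinfty.
have eta0 : 0 < 1 - theta by rewrite subr_gt0.
(* The summand 1 serves [z <= 0]; [2 / nu ^+ 2] serves [z > 0], where [e^y >= y^2 / 2] is applied to
   [y = nu * e^z]. *)
pose C := 1 + 2 / nu ^+ 2.
have C1 : 1 <= C by rewrite lerDl divr_ge0// sqr_ge0.
apply: (@le_lt_trans _ _ (\int[mu]_z (C%:E * (expR (- ((1 - theta) * `|z|)))%:E))%E); last first.
  rewrite ge0_integralZl//=.
  - by rewrite lte_mul_pinfty ?lee_fin ?(le_trans _ C1)// integral_expRN_norm_lty.
  - apply/measurable_EFinP; apply: measurableT_comp => //.
    by apply: measurableT_comp => //; apply: measurable_funM => //.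
  - by rewrite lee_fin (le_trans _ C1).
apply: ge0_le_integral => //=.
- by move=> z _; rewrite mule_ge0 ?lee_fin ?expR_ge0.
- apply: emeasurable_funM; last by apply/measurable_EFinP; exact: measurable_expR.
  by apply: (measurableT_comp mf); exact: measurable_expR.
- apply: measurable_funeM; apply/measurable_EFinP; apply: measurableT_comp => //.
  by apply: measurableT_comp => //; apply: measurable_funM => //.
move=> z _; rewrite -!EFinM lee_fin ger0_norm ?expR_ge0//.
rewrite mulrAC -expRM -expRD mulrN; have [z0|z0] := leP z 0.
  rewrite ler0_norm// (_ : - (z * theta) + z = - ((1 - theta) * - z)); last by ring.
  rewrite mulrC ler_pM ?expR_ge0// (le_trans _ C1)// -[leRHS]expR0 ler_expR oppr_le0.
  by rewrite mulr_ge0 ?expR_ge0// ltW.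
rewrite gtr0_norm//.
have y2 : expR (- (nu * expR z)) <= 2 / nu ^+ 2 * expR (- (z * 2)).
  rewrite expRN -[leRHS]invrK lef_pV2 ?posrE ?expR_gt0//; last first.
    by rewrite invr_gt0 mulr_gt0 ?expR_gt0// divr_gt0// exprn_gt0.
  rewrite invfM expRN invrK invf_div expRM_natr.
  have y0 : 0 <= nu * expR z by rewrite mulr_ge0 ?expR_ge0 ?ltW.
  have := expR_ge1Dxn 1 y0; rewrite exprMn => /(le_trans _); apply.
  by rewrite (_ : 2`! = 2)%N// [leLHS]mulrAC lerDr.
apply: (le_trans (ler_wpM2l (expR_ge0 _) y2)).
rewrite mulrCA -expRD; apply: ler_pM.
- by rewrite divr_ge0// sqr_ge0.
- exact: expR_ge0.
- by rewrite lerDr.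
- rewrite ler_expR -subr_ge0.
  rewrite (_ : _ - _ = 2 * (z * theta)); first by rewrite !mulr_ge0// ltW.
  by ring.
Qed.

(** The power carries the singularity on one half-line; the summand 1 covers the kernel across the
    origin, which is bounded at [x = 0], where the default value of a negative power is 0. *)
Definition kernel_majorant theta nu x : R :=
  (`|x| `^ (- theta) + 1) * expR (- (nu * `|x|)).

Lemma integrable_kernel_majorant theta nu : 0 <= theta < 1 -> 0 < nu ->
  mu.-integrable setT (EFin \o kernel_majorant theta nu).
Proof.
move=> t01 nu0.
have t001 : (0 : R) <= (0 : R) < 1 by rewrite lexx ltr01.
have mpe (t : R) : measurable_fun [set: R] (fun x : R => `|x| `^ (- t) * expR (- (nu * `|x|))).
  apply: measurable_funM.
    by apply: (measurableT_comp (measurable_powR (- t))); exact: normr_measurable.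
  apply: measurableT_comp => //; apply: measurableT_comp => //.
  by apply: measurable_funM => //.
have ipe (t : R) : 0 <= t < 1 -> mu.-integrable setT
    (fun x : R => (`|x| `^ (- t) * expR (- (nu * `|x|)))%:E).
  move=> h; apply/integrableP; split; first by apply/measurable_EFinP; exact: mpe.
  under eq_integral do rewrite gee0_abs ?lee_fin ?mulr_ge0 ?powR_ge0 ?expR_ge0//.
  exact: integral_powR_expRN_lty.
apply: eq_integrable (integrableD _ (ipe _ t01) (ipe _ t001)) => //=.
by move=> x _ /=; rewrite -EFinD /kernel_majorant oppr0 powRr0 mulrDl.
Qed.

(* [2 sinh (x / 2) = e^(x/2) (1 - e^-x) >= e^(x/2) x / (1 + x)] *)
Lemma sinh_ge x : 0 < x -> expR (x / 2) * (x / (1 + x)) <= expR (x / 2) - expR (- (x / 2)).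
Proof.
move=> x0; rewrite [X in _ - X](_ : _ = expR (x / 2) * expR (- x)); last first.
  by rewrite -expRD; congr expR; field.
rewrite -[X in X - _]mulr1 -mulrBr ler_pM2l ?expR_gt0//.
rewrite expRN lerBrDr -lerBrDl.
have x10 : 0 < 1 + x by rewrite addr_gt0.
rewrite (_ : 1 - _ = (1 + x)^-1); last by field; rewrite gt_eqF.
by rewrite lef_pV2 ?posrE ?expR_gt0// expR_ge1Dx.
Qed.

(** [sinh_ge] replaces the difference of exponentials by [e^(x/2) * y] with [y = x / (1 + x)]. The
    powers of [x] and [y] give the singularity and a factor [(1 + x)^3], which half of the
    exponential decay absorbs. *)
Lemma kernel_majorant_diag alpha x : 0 < alpha < 2 -> 0 < x ->
  x ^+ 2 * (expR (x / 2) - expR (- (x / 2))) `^ (- alpha - 1) *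
    expR (`|alpha - 1| * x / 2) <=
  (6 / Num.min 1 alpha) ^+ 3 *
    kernel_majorant `|alpha - 1| (Num.min 1 alpha / 2) x.
Proof.
move=> /andP[a0 a2] x0; rewrite /kernel_majorant (gtr0_norm x0).
set m := Num.min 1 alpha; set t : R := `|alpha - 1|.
have m0 : 0 < m by rewrite lt_min ltr01.
have m1 : m <= 1 by rewrite ge_min lexx.
have t0 : 0 <= t by exact: normr_ge0.
have t1 : t < 1 by rewrite /t ltr_norml; lra.
(* The decay rate left over after the largest admissible exponential growth. *)
have tm : t / 2 - (alpha + 1) / 2 = - m.
  by rewrite /t /m; case: ltP => h; [rewrite gtr0_norm; lra|rewrite ler0_norm; lra].
have x10 : 0 < 1 + x by rewrite addr_gt0.
set y := x / (1 + x).
have y0 : 0 < y by rewrite divr_gt0.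
have y1 : y <= 1 by rewrite ler_pdivrMr// mul1r lerDr.
have xE : x = (1 + x) * y by rewrite /y mulrC divfK// gt_eqF.
have h1 : (expR (x / 2) - expR (- (x / 2))) `^ (- alpha - 1) <=
    (expR (x / 2) * y) `^ (- alpha - 1).
  rewrite (_ : - alpha - 1 = - (alpha + 1)); last by ring.
  have A0 : 0 < expR (x / 2) * y by rewrite mulr_gt0// expR_gt0.
  have B0 := lt_le_trans A0 (sinh_ge x0).
  rewrite !powRN lef_pV2 ?posrE ?powR_gt0//.
  rewrite ge0_ler_powR ?nnegrE ?(ltW A0) ?(ltW B0) ?sinh_ge//; lra.
have h2 : x ^+ 2 * y `^ (- alpha - 1) <= (1 + x) ^+ 3 * x `^ (- t).
  rewrite {1}xE exprMn -mulrA -(powR_mulrn 2 (ltW y0)) -powRD; last first.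
    by rewrite (gt_eqF y0) implybT.
  apply: (@le_trans _ _ ((1 + x) ^+ 2 * y `^ (- t))).
    rewrite ler_pM2l ?exprn_gt0// ger_powR ?y0//.
    have : - t <= - (alpha - 1) by rewrite lerN2 ler_norm.
    lra.
  rewrite (exprSr _ 2) -mulrA ler_pM2l ?exprn_gt0// /y.
  rewrite powRM ?(ltW x0) ?invr_ge0 ?(ltW x10)// mulrC ler_wpM2r ?powR_ge0//.
  rewrite -powR_inv1 ?(ltW x10)// -powRrM mulN1r opprK.
  by rewrite ler1_powR// ?lerDl ltW.
(* Each factor satisfies [1 + x <= (6 / m) * (1 + m * x / 6)], and three exponentials of rate
   [m / 6] use up exactly half of the rate [m]. *)
have h3 : (1 + x) ^+ 3 <= (6 / m) ^+ 3 * expR (m / 2 * x).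
  have -> : expR (m / 2 * x) = expR (m / 6 * x) ^+ 3.
    by rewrite -expRM_natr; congr expR; field.
  rewrite -exprMn lerXn2r ?nnegrE ?mulr_ge0 ?divr_ge0 ?invr_ge0 ?expR_ge0 ?(ltW m0) ?(ltW x10)//.
  rewrite -ler_pdivrMl ?divr_gt0// invf_div.
  apply: le_trans (expR_ge1Dx _); rewrite mulrDr mulr1 lerD2r.
  by lra.
have e1 : expR (x / 2) `^ (- alpha - 1) * expR (t * x / 2) = expR (- (m * x)).
  rewrite -expRM -expRD; congr expR.
  transitivity ((t / 2 - (alpha + 1) / 2) * x); first by field.
  by rewrite tm; ring.
have e2 : expR (m / 2 * x) * expR (- (m * x)) = expR (- (m / 2 * x)).
  by rewrite -expRD; congr expR; field.
apply: (@le_trans _ _ (x ^+ 2 * y `^ (- alpha - 1) * expR (- (m * x)))).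
  rewrite -e1 [leRHS](_ : _ = x ^+ 2 * (expR (x / 2) * y) `^ (- alpha - 1) *
    expR (t * x / 2)); last by rewrite powRM ?expR_ge0 ?(ltW y0)//; ring.
  by rewrite ler_wpM2r ?expR_ge0// ler_wpM2l ?sqr_ge0.
apply: (le_trans (ler_wpM2r (expR_ge0 _) h2)).
apply: (@le_trans _ _ ((6 / m) ^+ 3 * x `^ (- t) * expR (- (m / 2 * x)))).
  rewrite -e2 [leRHS](_ : _ = (6 / m) ^+ 3 * expR (m / 2 * x) * x `^ (- t) *
    expR (- (m * x))); last by ring.
  by rewrite !ler_wpM2r ?expR_ge0 ?powR_ge0.
rewrite -mulrA ler_wpM2l ?exprn_ge0 ?divr_ge0 ?invr_ge0 ?(ltW m0)//.
by rewrite ler_wpM2r ?expR_ge0// lerDl.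
Qed.

End kernel_majorant.

(* [true] encodes the positive half-line. *)
Definition side (R : realType) (b : bool) : R := if b then 1 else -1.

(* The kernel in the logarithmic coordinate [a = ln `|y / x|], normalized by
   [`|x * y| = 1]; homogeneity recovers [k] from it, and [fine] changes its value
   at most on the diagonal [b = d], [a = 0]. *)
Definition log_kernel (R : realType) (k : R * R -> \bar R) (b d : bool)
    (a : R) : R :=
  fine (k (side R b * expR (- (a / 2)), side R d * expR (a / 2))).

(** * Homogeneity and size of the kernel in logarithmic coordinates *)

Section log_kernel.
Context {R : realType} (alpha : R) (k : R * R -> \bar R).
Hypotheses (halpha : 0 < alpha < 2) (hk : kernel_class alpha k).
Local Notation n := (log_kernel k).
Local Notation mu := (@lebesgue_measure R).
Implicit Types (b d : bool) (a c z : R).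

Lemma log_kernel_ge0 b d a : 0 <= n b d a.
Proof. by apply: fine_ge0; exact: (kernel_ge0 hk). Qed.

Lemma log_kernelN b d a : n b d (- a) = n d b a.
Proof. by rewrite /log_kernel (kernel_sym hk) mulNr opprK. Qed.

Lemma norm_side b : `|side R b| = 1.
Proof. by case: b; rewrite /side/= ?normrN normr1. Qed.

Lemma measurable_log_kernel b d : measurable_fun setT (n b d).
Proof.
apply: (measurableT_comp (f := fine)); first exact: fine_measurable.
apply: (measurableT_comp (kernel_measurable hk)).
apply: measurable_fun_pair; apply: measurable_funM => //;
  apply: measurableT_comp => //; last exact: measurable_funM.
by apply: measurableT_comp => //; exact: measurable_funM.
Qed.

Lemma dist_log_ge b d a :
  expR (`|a| / 2) - expR (- (`|a| / 2)) <=
  `|side R b * expR (- (a / 2)) - side R d * expR (a / 2)|.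
Proof.
apply: le_trans (ler_dist_dist _ _).
rewrite !normrM !norm_side !mul1r !(ger0_norm (expR_ge0 _)).
have [a0|a0] := ger0P a.
  by rewrite distrC ler_norm.
by rewrite mulNr opprK ler_norm.
Qed.

Lemma dist_log_neq_ge b d a : b != d ->
  expR (`|a| / 2) <=
  `|side R b * expR (- (a / 2)) - side R d * expR (a / 2)|.
Proof.
move=> bd; have -> : `|side R b * expR (- (a / 2)) - side R d * expR (a / 2)| =
    expR (- (a / 2)) + expR (a / 2).
  case: b d bd => [] [] //= _.
    by rewrite mulN1r opprK mul1r ger0_norm// addr_ge0 ?expR_ge0.
  by rewrite mulN1r mul1r -opprD normrN ger0_norm// addr_ge0 ?expR_ge0.
have [a0|a0] := ger0P a; first by rewrite lerDr expR_ge0.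
by rewrite mulNr lerDl expR_ge0.
Qed.

Lemma kernel_logE b d a : (b != d) || (a != 0) ->
  k (side R b * expR (- (a / 2)), side R d * expR (a / 2)) = (n b d a)%:E.
Proof.
move=> bda; rewrite /log_kernel fineK// ge0_fin_numE; last exact: (kernel_ge0 hk).
have [c c0 hc] := kernel_bounded hk.
apply: le_lt_trans (hc _ _ _) (ltry _).
rewrite -subr_eq0 -normr_gt0; case/orP: bda => [bd|a0].
  exact: lt_le_trans (dist_log_neq_ge _ bd).
apply: lt_le_trans (dist_log_ge _ _ _).
have := normr_gt0 a; rewrite a0 => a1.
by rewrite subr_gt0 ltr_expR; lra.
Qed.

(** The scaling factor is [expR (z + a / 2)], the geometric mean of the two distances to the
    origin. *)
Lemma kernel_homogeneous_log b d a z :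
  k (side R b * expR z, side R d * expR (z + a)) =
  ((expR (- (alpha + 1) * (z + a / 2)))%:E *
   k (side R b * expR (- (a / 2)), side R d * expR (a / 2))%R)%E.
Proof.
have h : 0 < expR (z + a / 2) by exact: expR_gt0.
have := kernel_homogeneous hk (side R b * expR (- (a / 2))) (side R d * expR (a / 2)) h.
rewrite -expRM (_ : (z + a / 2) * (- alpha - 1) = - (alpha + 1) * (z + a / 2)); last by ring.
by move=> <-; congr (k (_, _)); rewrite mulrCA -expRD; congr (_ * expR _); field.
Qed.

Definition log_majorant : R -> R :=
  kernel_majorant `|alpha - 1| (Num.min 1 alpha / 2).

Lemma log_majorant_ge0 a : 0 <= log_majorant a.
Proof. by rewrite mulr_ge0 ?expR_ge0// addr_ge0 ?powR_ge0. Qed.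

Lemma integrable_log_majorant : mu.-integrable setT (EFin \o log_majorant).
Proof.
apply: integrable_kernel_majorant.
  by rewrite normr_ge0 ltr_norml; case/andP: halpha; lra.
by rewrite divr_gt0// lt_min ltr01; case/andP: halpha.
Qed.

Lemma log_kernel_le : exists2 C, 0 <= C &
  forall c, `|c| <= `|alpha - 1| / 2 -> forall b d a,
    a ^+ 2 * expR (c * a) * n b d a <= C * log_majorant a /\
    (b != d -> expR (c * a) * n b d a <= C * log_majorant a).
Proof.
have [c0 c00 hc0] := kernel_bounded hk.
have /andP[al0 al2] := halpha.
pose m := Num.min 1 alpha.
have m0 : 0 < m by rewrite lt_min ltr01.
have m1 : m <= 1 by rewrite ge_min lexx.
have m6 : 1 <= (6 / m) ^+ 3.
  by rewrite exprn_ege1// ler_pdivlMr// mul1r; lra.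
exists (c0 * (6 / m) ^+ 3); first by rewrite mulr_ge0 ?(le_trans _ m6)// ltW.
move=> c hc b d a.
have hca : expR (c * a) <= expR (`|alpha - 1| * `|a| / 2).
  rewrite ler_expR (le_trans (ler_norm _))// normrM mulrAC.
  by rewrite ler_wpM2r.
have nle (r : R) : 0 < r -> (b != d) || (a != 0) ->
    r <= `|side R b * expR (- (a / 2)) - side R d * expR (a / 2)| ->
    n b d a <= c0 * r `^ (- alpha - 1).
  move=> r0 bda rle; rewrite -lee_fin -kernel_logE//.
  apply: le_trans (hc0 _ _ _) _.
    by rewrite -subr_eq0 -normr_gt0 (lt_le_trans r0).
  rewrite lee_fin ler_pM2l// (_ : - alpha - 1 = - (alpha + 1)); last by ring.
  rewrite !powRN lef_pV2 ?posrE ?powR_gt0 ?(lt_le_trans r0)//.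
  by rewrite ge0_ler_powR ?nnegrE ?(ltW r0)//; lra.
split.
  have [->|a0] := eqVneq a 0.
    rewrite expr0n/= !mul0r mulr_ge0 ?log_majorant_ge0// mulr_ge0 ?(ltW c00)//.
    exact: le_trans m6.
  have na0 : 0 < `|a| by rewrite normr_gt0.
  have r0 : 0 < expR (`|a| / 2) - expR (- (`|a| / 2)).
    by rewrite subr_gt0 ltr_expR; lra.
  have := nle _ r0; rewrite a0 orbT => /(_ isT (dist_log_ge _ _ _)) h1.
  have h2 := kernel_majorant_diag halpha na0.
  have -> : log_majorant a = log_majorant `|a|.
    by rewrite /log_majorant /kernel_majorant normr_id.
  rewrite -[leRHS]mulrA; apply: (le_trans _ (ler_wpM2l (ltW c00) h2)).
  rewrite -[a ^+ 2]real_normK ?num_real//.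
  rewrite [leRHS](_ : _ = `|a| ^+ 2 * expR (`|alpha - 1| * `|a| / 2) *
    (c0 * (expR (`|a| / 2) - expR (- (`|a| / 2))) `^ (- alpha - 1))); last by ring.
  apply: ler_pM => //; rewrite ?log_kernel_ge0 ?mulr_ge0 ?sqr_ge0 ?expR_ge0//.
  by rewrite ler_wpM2l ?sqr_ge0.
move=> bd; have := nle _ (expR_gt0 _); rewrite bd => /(_ _ isT (dist_log_neq_ge _ bd)) h1.
have h2 := ler_pM (expR_ge0 _) (log_kernel_ge0 b d a) hca h1.
apply: (le_trans h2); rewrite mulrCA -expRM -expRD -[leRHS]mulrA ler_pM2l//.
have : 1 * 1 * expR (- (m / 2 * `|a|)) <= (6 / m) ^+ 3 * log_majorant a.
  rewrite -mulrA ler_pM ?mulr_ge0 ?expR_ge0// ler_wpM2r ?expR_ge0//.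
  by rewrite lerDr powR_ge0.
rewrite !mul1r; apply: le_trans; rewrite ler_expR.
(* The rate is again [- m]; the majorant asks only for half of it. *)
rewrite (_ : _ + _ = (`|alpha - 1| / 2 - (alpha + 1) / 2) * `|a|); last by field.
rewrite -[leRHS]mulNr ler_wpM2r//.
by rewrite /m; case: (ltP 1 alpha) => h; [rewrite gtr0_norm; lra|rewrite ler0_norm; lra].
Qed.

End log_kernel.

(** * The energy in logarithmic coordinates *)

Section energy_log.
Context {R : realType} (alpha p : R) (k : R * R -> \bar R).
Hypotheses (halpha : 0 < alpha < 2) (hp : 1 < p) (hk : kernel_class alpha k).
Local Notation n := (log_kernel k).
Local Notation mu := (@lebesgue_measure R).
Implicit Types (b d : bool) (a z : R) (u : R -> R).

(** The exponent collects [- (alpha + 1)] from homogeneity and 2 from the Jacobians [expR z] and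
    [expR (z + a)]. *)
Definition log_energy u b d a z : R :=
  expR (- (alpha - 1) * (z + a / 2)) *
  energy_gap p (u (side R b * expR z)) (u (side R d * expR (z + a))).

Lemma log_energy_ge0 u b d a z : 0 <= log_energy u b d a z.
Proof. by rewrite mulr_ge0 ?expR_ge0// energy_gap_ge0. Qed.

Lemma energy_integrand_log u b d a z :
  (((energy_gap p (u (side R b * expR z)%R) (u (side R d * expR (z + a))%R))%:E *
     k (side R b * expR z, side R d * expR (z + a))%R) * (expR (z + a))%:E *
   (expR z)%:E)%E = (log_energy u b d a z * n b d a)%:E.
Proof.
rewrite /log_energy (kernel_homogeneous_log hk).
(* On the diagonal the gap is 0, and [0 * +oo = 0] makes both sides vanish even where [k] is
   infinite. *)
have [|] := boolP ((b != d) || (a != 0)); last first.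
  rewrite negb_or !negbK => /andP[/eqP -> /eqP ->]; rewrite addr0.
  by rewrite /energy_gap !subrr !mul0r mulr0 !mul0r !mul0e.
move=> bda; rewrite (kernel_logE hk bda) -!EFinM; congr EFin.
rewrite (_ : expR (- (alpha - 1) * (z + a / 2)) =
  expR (- (alpha + 1) * (z + a / 2)) * expR (z + a) * expR z); first by ring.
by rewrite -!expRD; congr expR; field.
Qed.

Lemma measurable_energy_gap disp (T : measurableType disp) (f g : T -> R) :
  measurable_fun setT f -> measurable_fun setT g ->
  measurable_fun setT (fun x => energy_gap p (f x) (g x)).
Proof.
move=> mf mg; apply: measurable_funM; apply: measurable_funB => //.
  exact: (measurableT_comp (measurable_spow (p - 1))).
exact: (measurableT_comp (measurable_spow (p - 1))).
Qed.

Lemma measurable_log_energy u b d : measurable_fun setT u ->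
  measurable_fun setT (fun x : R * R => log_energy u b d x.2 x.1).
Proof.
move=> mu'; apply: measurable_funM.
  apply: measurableT_comp => //; apply: measurable_funM => //.
  by apply: measurable_funD => //; apply: measurable_funM.
apply: measurable_energy_gap; apply: (measurableT_comp mu').
  by apply: measurable_funM => //; apply: measurableT_comp.
apply: measurable_funM => //; apply: measurableT_comp => //.
exact: measurable_funD.
Qed.

(** The integral over [a] is the outer one: the lower bound is integrated in [z] at fixed [a], where
    no singularity interferes. *)
Definition log_energy_integral u b d : \bar R :=
  (\int[mu]_a \int[mu]_z (log_energy u b d a z * n b d a)%:E)%E.

Let Kfun u (x : R * R) : \bar R := ((energy_gap p (u x.1) (u x.2))%:E * k x)%E.

Let mK u : measurable_fun setT u -> measurable_fun setT (Kfun u).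
Proof.
move=> mu'; apply: emeasurable_funM; last exact: (kernel_measurable hk).
apply/measurable_EFinP; apply: measurable_energy_gap; exact: measurableT_comp.
Qed.

Let K0 u x : (0 <= Kfun u x)%E.
Proof.
case: x => x y; apply: mule_ge0; last exact: (kernel_ge0 hk).
by rewrite lee_fin energy_gap_ge0.
Qed.

Let mJ u b d : measurable_fun setT u ->
  measurable_fun setT (fun x : R * R => (log_energy u b d x.2 x.1 * n b d x.2)%:E).
Proof.
move=> mu'; apply/measurable_EFinP; apply: measurable_funM.
  exact: measurable_log_energy.
by apply: (measurableT_comp (measurable_log_kernel hk b d)).
Qed.

Let J0 u b d a z : (0 <= (log_energy u b d a z * n b d a)%:E)%E.
Proof. by rewrite lee_fin mulr_ge0 ?log_energy_ge0// (log_kernel_ge0 hk). Qed.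

Lemma energy_log u : measurable_fun setT u ->
  energy k p u = ((2^-1)%:E *
   ((log_energy_integral u true true + log_energy_integral u true false) +
    (log_energy_integral u false true + log_energy_integral u false false)))%E.
Proof.
move=> mu'; rewrite /energy; congr (_ * _)%E.
pose F x := (\int[mu]_y Kfun u (x, y))%E.
have mF : measurable_fun setT F.
  exact: (measurable_fun_fubini_tonelli_F (m2 := mu) (Kfun u) (mK mu')).
have F0 x : (0 <= F x)%E by apply: integral_ge0.
transitivity (\int[mu]_x F x)%E; first by [].
have side_expR : forall b z, (if b then expR z else - expR z) = side R b * expR z.
  by case=> z; rewrite /side ?mul1r ?mulN1r.
rewrite (ge0_integral_expR_sum mF F0).
pose Fz b z := (F (side R b * expR z)%R * (expR z)%:E)%E.
have inner b z : Fz b z = (\int[mu]_a (log_energy u b true a z * n b true a)%:E +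
    \int[mu]_a (log_energy u b false a z * n b false a)%:E)%E.
  rewrite /Fz /F; set x := side R b * expR z.
  have mKx : measurable_fun setT (fun y => Kfun u (x, y)).
    exact: (measurableT_comp (mK mu')).
  have expz0 : (0 <= (expR z)%:E)%E by rewrite lee_fin expR_ge0.
  have part d : ((\int[mu]_w (Kfun u (x, side R d * expR w)%R * (expR w)%:E)) * (expR z)%:E =
      \int[mu]_a (log_energy u b d a z * n b d a)%:E)%E.
    have mg : measurable_fun setT (fun w => Kfun u (x, side R d * expR w)%R * (expR w)%:E)%E.
      apply: emeasurable_funM; last first.
        by apply/measurable_EFinP; exact: measurable_expR.
      by apply: (measurableT_comp mKx); apply: measurable_funM.
    have g0 w : (0 <= Kfun u (x, side R d * expR w)%R * (expR w)%:E)%E.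
      by rewrite mule_ge0 ?K0// lee_fin expR_ge0.
    (* The shift [w = z + a] replaces the coordinate of the second point by its logarithmic
       displacement from the first. *)
    rewrite -(ge0_integral_translate z mg g0) -ge0_integralZr//; last first.
      apply: (measurableT_comp mg); exact: measurable_funD.
    by apply: eq_integral => a _; rewrite -energy_integrand_log.
  rewrite (ge0_integral_expR_sum mKx)// ge0_muleDl; last 2 first.
  - by apply: integral_ge0 => w _; rewrite mule_ge0 ?K0// lee_fin expR_ge0.
  - by apply: integral_ge0 => w _; rewrite mule_ge0 ?K0// lee_fin expR_ge0.
  congr (_ + _)%E; rewrite -part; congr (_ * _)%E; apply: eq_integral => w _.
    by rewrite -side_expR.
  by rewrite -side_expR.
have mG b d : measurable_fun setT (fun z => \int[mu]_a (log_energy u b d a z * n b d a)%:E)%E.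
  exact: (measurable_fun_fubini_tonelli_F (m2 := mu) _ (mJ b d mu')).
have outer b : (\int[mu]_z Fz b z)%E =
    (log_energy_integral u b true + log_energy_integral u b false)%E.
  under eq_integral do rewrite inner.
  have G0 d z : setT z -> (0 <= \int[mu]_a (log_energy u b d a z * n b d a)%:E)%E.
    by move=> _; apply: integral_ge0 => a _; exact: J0.
  rewrite (ge0_integralD mu measurableT (G0 true) (mG b true) (G0 false) (mG b false)).
  rewrite /log_energy_integral.
  rewrite (fubini_tonelli (m1 := mu) (m2 := mu) _ (mJ b true mu'))/=; last by move=> x; exact: J0.
  by rewrite (fubini_tonelli (m1 := mu) (m2 := mu) _ (mJ b false mu'))//=; move=> x; exact: J0.
congr (_ + _)%E; rewrite -outer; apply: eq_integral => z _; rewrite /Fz.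
  by rewrite -side_expR.
by rewrite -side_expR.
Qed.

End energy_log.

(** * Reflection, even integrands and substitution on the unit interval *)

Section reflection.
Context {R : realType}.
Local Notation mu := (@lebesgue_measure R).
Local Open Scope ereal_scope.

Lemma integral_oppr (f : R -> \bar R) : measurable_fun setT f ->
  \int[mu]_x f (- x)%R = \int[mu]_x f x.
Proof.
move=> mf; rewrite integralE [RHS]integralE.
rewrite -(ge0_integralN (measurable_funepos mf)); last by move=> x; exact: funepos_ge0.
rewrite -(ge0_integralN (measurable_funeneg mf)); last by move=> x; exact: funeneg_ge0.
by congr (_ - _); apply: eq_integral => x _; rewrite ?funeposE ?funenegE.
Qed.

Lemma ge0_integral_even (f : R -> \bar R) : measurable_fun setT f ->
  (forall x, 0 <= f x) -> (forall x, f (- x)%R = f x) ->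
  \int[mu]_x f x = 2%:E * \int[mu]_(x in `]-oo, 0%R[) f x.
Proof.
move=> mf f0 fN.
rewrite -(setUv `[0%R, +oo[%classic) ge0_integral_setU//=; last 3 first.
- exact: measurableC.
- by rewrite setUv.
- exact/disj_setPCl.
rewrite setCitvr ge0_integration_by_substitution0//.
under eq_integral do rewrite fN.
rewrite -integral_itv_bndo_bndc; last exact: measurable_funTS.
by rewrite [RHS]mule_natl mule2n.
Qed.

Lemma ge0_integral_expR_itv01 (f : R -> \bar R) : measurable_fun setT f ->
  (forall x, 0 <= f x) ->
  \int[mu]_(x in `]0%R, 1%R[) f x =
  \int[mu]_(z in `]-oo, 0%R[) (f (expR z) * (expR z)%:E).
Proof.
move=> mf f0.
have -> : (`]0%R, 1%R[ = `]0%R, +oo[ `&` `]0%R, 1%R[ :> set R)%classic.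
  apply/seteqP; split => x /=; last by case.
  by rewrite !in_itv/= => /andP[-> ->].
rewrite integral_mkcondr ge0_integral_expR; last 2 first.
- apply/(measurable_restrictT _ _).1 => //; exact: measurable_funTS.
- by move=> x; rewrite erestrict_ge0.
rewrite [RHS]integral_mkcond; apply: eq_integral => z _.
rewrite !patchE; have -> : (expR z \in `]0%R, 1%R[%classic) = (z \in `]-oo, 0%R[%classic).
  by rewrite !mem_setE !in_itv/= expR_gt0 expR_lt1.
by case: ifP => // _; rewrite mul0e.
Qed.

End reflection.

(** * The constants [D_pos] and [D_neg] as integrals over the logarithmic displacement *)

Section constants.
Context {R : realType} (alpha p s : R) (k : R * R -> \bar R).
Hypotheses (halpha : 0 < alpha < 2) (hp : 1 < p) (hs : 0 < s).
Hypothesis hk : kernel_class alpha k.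
Local Notation n := (log_kernel k).
Local Notation mu := (@lebesgue_measure R).
Local Notation beta := (alpha - 1).
Local Notation q := (conj_exp p).
Implicit Types (b d : bool) (a z c rho t x y : R).

Let p0 : 0 < p. Proof. by rewrite (lt_trans _ hp). Qed.
Let q0 : 0 < q. Proof. by rewrite (lt_trans _ (conj_exp_gt1 hp)). Qed.
Let pq1 : p^-1 + q^-1 = 1. Proof. exact: conj_expE. Qed.

(** The integrand factor of [gamma_pos] and [gamma_neg] at [t = expR a] and [rho = beta / p], for
    which [beta - rho = beta / q]; the leading exponential comes from the kernel and [dt]. *)
Definition diag_weight a : R := expR (- beta / 2 * a) *
  ((1 - expR (beta / p * a)) * (1 - expR (beta / q * a))).

(* The ratio of heights of the ground state across the origin, when leaving
   side [b]. *)
Definition side_ratio b : R := if b then s `^ p^-1 else (s `^ p^-1)^-1.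

Lemma side_ratio_gt0 b : 0 < side_ratio b.
Proof. by case: b; rewrite /side_ratio ?invr_gt0 powR_gt0. Qed.

Lemma onem_expR_ge0 (x y : R) : 0 <= x * y -> 0 <= (1 - expR x) * (1 - expR y).
Proof.
move=> xy; have [x0|x0|->] := ltgtP x 0; last by rewrite expR0 subrr mul0r.
  have y0 : y <= 0 by rewrite -(nmulr_rge0 _ x0).
  by rewrite mulr_ge0// subr_ge0 expR_le1// ltW.
have y0 : 0 <= y by rewrite -(pmulr_rge0 _ x0).
by rewrite mulr_le0// subr_le0 -expR0 ler_expR// ltW.
Qed.

Lemma onem_powR_ge0 t rho1 rho2 : 0 <= rho1 * rho2 ->
  0 <= (1 - t `^ rho1) * (1 - t `^ rho2).
Proof.
move=> h; have [t0|t0|->] := ltgtP t 0.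
- by rewrite !lt0_powR1// subrr mul0r.
- rewrite /powR gt_eqF//; apply: onem_expR_ge0.
  by rewrite mulrACA mulr_ge0// -expr2 sqr_ge0.
- by rewrite /powR eqxx; do 2 case: eqP => _; rewrite ?subrr ?subr0 ?mulr0 ?mul0r ?mulr1.
Qed.

Lemma diag_weight_ge0 a : 0 <= diag_weight a.
Proof.
rewrite mulr_ge0 ?expR_ge0// onem_expR_ge0//.
by rewrite mulrACA mulr_ge0 -?expr2 ?sqr_ge0// mulrACA -expr2 mulr_ge0 ?sqr_ge0// mulr_ge0// invr_ge0 ltW.
Qed.

(** Factoring [expR (x + y)] out of [(1 - expR x) * (1 - expR y)] reverses both signs. By this
    evenness the integral over [t < 1], that is [a < 0], is half of the one over the line. *)
Lemma even_weight rho a :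
  expR (- beta / 2 * - a) *
    ((1 - expR (rho * - a)) * (1 - expR ((beta - rho) * - a))) =
  expR (- beta / 2 * a) *
    ((1 - expR (rho * a)) * (1 - expR ((beta - rho) * a))).
Proof.
have e x y : (1 - expR x) * (1 - expR y) =
    expR (x + y) * ((1 - expR (- x)) * (1 - expR (- y))).
  have ex : expR x * expR (- x) = 1 by rewrite expRxMexpNx_1.
  have ey : expR y * expR (- y) = 1 by rewrite expRxMexpNx_1.
  rewrite expRD [RHS](_ : _ = (expR x - expR x * expR (- x)) *
    (expR y - expR y * expR (- y))); last by ring.
  by rewrite ex ey; ring.
rewrite [in RHS]e mulrA -expRD !mulrN; congr (expR _ * _).
by field.
Qed.

Lemma norm_onem_expR_le x : `|1 - expR x| <= `|x| * expR (Num.max x 0).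
Proof.
have [x0|x0] := leP x 0.
  rewrite expR0 mulr1 (ler0_norm x0) ger0_norm ?subr_ge0 ?expR_le1//.
  by rewrite lerBlDr -lerBlDl opprK expR_ge1Dx.
rewrite (gtr0_norm x0) ltr0_norm ?subr_lt0 ?expR_gt1// opprB.
have := expR_ge1Dx (- x); rewrite expRN => h.
have ex := expR_gt0 x; have := ler_wpM2r (ltW ex) h.
by rewrite mulVf ?gt_eqF// mulrDl mul1r; lra.
Qed.

(** Each factor [1 - expR _] contributes one power of [a], and the total growth is that of
    [expR (|beta * a| / 2)], the borderline case of [log_kernel_le]. *)
Lemma diag_weight_le a : diag_weight a <=
  (beta ^+ 2 / (p * q)) * (a ^+ 2 * (expR (beta / 2 * a) + expR (- beta / 2 * a))).
Proof.
rewrite /diag_weight -[X in _ * X <= _]ger0_norm; last first.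
  apply: onem_expR_ge0.
  by rewrite mulrACA mulr_ge0 -?expr2 ?sqr_ge0// mulrACA -expr2 mulr_ge0 ?sqr_ge0// mulr_ge0// invr_ge0 ltW.
rewrite normrM.
have h := ler_pM (normr_ge0 _) (normr_ge0 _) (norm_onem_expR_le (beta / p * a))
  (norm_onem_expR_le (beta / q * a)).
apply: (le_trans (ler_wpM2l (expR_ge0 _) h)).
rewrite mulrACA -expRD -normrM.
(* Both arguments have the sign of [beta * a], so the positive parts add up. *)
have -> : Num.max (beta / p * a) 0 + Num.max (beta / q * a) 0 = Num.max (beta * a) 0.
  have e r : 0 < r -> Num.max (beta / r * a) 0 = r^-1 * Num.max (beta * a) 0.
    by move=> r0; rewrite maxr_pMr ?invr_ge0 ?ltW// mulr0; congr Num.max; ring.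
  by rewrite !e// -mulrDl pq1 mul1r.
have -> : `|beta / p * a * (beta / q * a)| = beta ^+ 2 / (p * q) * a ^+ 2.
  rewrite (_ : _ * _ = beta ^+ 2 / (p * q) * a ^+ 2); last by field; rewrite !gt_eqF.
  by rewrite ger0_norm// mulr_ge0 ?sqr_ge0// divr_ge0 ?sqr_ge0// mulr_ge0 ?(ltW p0) ?(ltW q0).
set B := beta ^+ 2 / (p * q).
have B0 : 0 <= B by rewrite divr_ge0 ?sqr_ge0// mulr_ge0 ?(ltW p0) ?(ltW q0).
rewrite [leLHS](_ : _ = B * (a ^+ 2 *
  (expR (- beta / 2 * a) * expR (Num.max (beta * a) 0)))); last by ring.
rewrite ler_wpM2l// ler_wpM2l ?sqr_ge0// -expRD; have [h0|h0] := leP (beta * a) 0.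
  by rewrite addr0 lerDr expR_ge0.
rewrite (_ : _ + beta * a = beta / 2 * a); last by field.
by rewrite lerDl expR_ge0.
Qed.

Definition diag_integral b : R := (\int[mu]_a (diag_weight a * n b b a))%R.

Definition cross_moment b c : R := (\int[mu]_a (expR (c * a) * n b (~~ b) a))%R.

Definition cross_integral b : R :=
  cross_moment b (- beta / 2)
  - p^-1 * side_ratio b `^ (p - 1) * cross_moment b (beta / q - beta / 2)
  - q^-1 * side_ratio b * cross_moment b (beta / p - beta / 2).

Lemma measurable_expRM c : measurable_fun setT (fun a : R => expR (c * a)).
Proof. by apply: measurableT_comp => //; exact: measurable_funM. Qed.

Lemma measurable_diag_weight : measurable_fun setT diag_weight.
Proof.
apply: measurable_funM; first exact: measurable_expRM.
by apply: measurable_funM; apply: measurable_funB => //; exact: measurable_expRM.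
Qed.

Lemma integrable_log_kernel_sqr b d c : `|c| <= `|beta| / 2 ->
  mu.-integrable setT (fun a => (a ^+ 2 * expR (c * a) * n b d a)%:E).
Proof.
move=> hc; have [C C0 hC] := log_kernel_le halpha hk.
apply: (le_integrable _ _ _ (integrableZl measurableT C (integrable_log_majorant halpha))) => //=.
- apply/measurable_EFinP; apply: measurable_funM; last exact: (measurable_log_kernel hk b d).
  by apply: measurable_funM; [exact: measurable_funX|exact: measurable_expRM].
- move=> a _; have [h _] := hC c hc b d a.
  have h0 : 0 <= a ^+ 2 * expR (c * a) * n b d a.
    by rewrite mulr_ge0 ?(log_kernel_ge0 hk)// mulr_ge0 ?expR_ge0// sqr_ge0.
  rewrite lee_fin (ger0_norm h0).
  by rewrite ger0_norm// mulr_ge0 ?log_majorant_ge0.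
Qed.

Lemma integrable_cross b c : `|c| <= `|beta| / 2 ->
  mu.-integrable setT (fun a => (expR (c * a) * n b (~~ b) a)%:E).
Proof.
move=> hc; have [C C0 hC] := log_kernel_le halpha hk.
apply: (le_integrable _ _ _ (integrableZl measurableT C (integrable_log_majorant halpha))) => //=.
- apply/measurable_EFinP; apply: measurable_funM; last exact: (measurable_log_kernel hk b _).
  exact: measurable_expRM.
- move=> a _; have [_ h] := hC c hc b (~~ b) a.
  rewrite lee_fin ger0_norm ?mulr_ge0 ?expR_ge0 ?(log_kernel_ge0 hk)//.
  rewrite ger0_norm ?mulr_ge0 ?log_majorant_ge0//.
  by apply: h; case: b.
Qed.

Lemma norm_half_beta : `|beta / 2| <= `|beta| / 2.
Proof. by rewrite normrM (@ger0_norm _ 2^-1) ?invr_ge0. Qed.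

Lemma norm_half_betaN : `|- beta / 2| <= `|beta| / 2.
Proof. by rewrite mulNr normrN norm_half_beta. Qed.

Lemma norm_exponent r : 1 < r -> `|beta / r - beta / 2| <= `|beta| / 2.
Proof.
move=> r1; rewrite -mulrBr normrM ler_wpM2l//.
have : 0 < r^-1 < 1 by rewrite invr_gt0 (lt_trans _ r1)//= invf_lt1// (lt_trans _ r1).
by move=> /andP[h1 h2]; rewrite ler_norml; lra.
Qed.

Lemma integrable_diag b :
  mu.-integrable setT (fun a => (diag_weight a * n b b a)%:E).
Proof.
have h1 := integrable_log_kernel_sqr b b norm_half_beta.
have h2 := integrable_log_kernel_sqr b b norm_half_betaN.
have h3 := integrableZl measurableT (beta ^+ 2 / (p * q)) (integrableD measurableT h1 h2).
apply: (le_integrable _ _ _ h3) => //=.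
- apply/measurable_EFinP; apply: measurable_funM; last exact: (measurable_log_kernel hk b b).
  exact: measurable_diag_weight.
- move=> a _; have h0 : 0 <= diag_weight a * n b b a.
    by apply: mulr_ge0; [exact: diag_weight_ge0|exact: (log_kernel_ge0 hk)].
  rewrite lee_fin (ger0_norm h0); apply: (le_trans _ (ler_norm _)).
  rewrite -mulrDl -mulrDr mulrA ler_wpM2r ?(log_kernel_ge0 hk)//.
  exact: diag_weight_le.
Qed.

(** Homogeneity contributes [- (alpha + 1) / 2] to the exponent and the Jacobian contributes 1. *)
Lemma kernel_side_expR b d z : (b != d) || (z != 0) ->
  (k (side R b, side R d * expR z)%R * (expR z)%:E)%E =
  (expR (- beta / 2 * z) * n b d z)%:E.
Proof.
move=> bz; have := kernel_homogeneous_log hk b d z 0.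
rewrite expR0 mulr1 !add0r => ->; rewrite (kernel_logE hk bz) -!EFinM.
by congr EFin; rewrite mulrAC -expRD; congr (expR _ * _); field.
Qed.

Lemma measurable_kernel_side b d :
  measurable_fun setT (fun t : R => k (side R b, side R d * t)).
Proof.
apply: (measurableT_comp (kernel_measurable hk)).
by apply: measurable_fun_pair => //; exact: measurable_funM.
Qed.

Lemma gammaE b rho : 0 <= rho * (beta - rho) ->
  (\int[mu]_(t in `]0%R, 1%R[)
    (((1 - t `^ rho) * (1 - t `^ (beta - rho)))%:E * k (side R b, side R b * t)%R))%E =
  (2^-1%:E * \int[mu]_a (expR (- beta / 2 * a) *
    ((1 - expR (rho * a)) * (1 - expR ((beta - rho) * a))) * n b b a)%:E)%E.
Proof.
move=> hrho.
pose f t := (((1 - t `^ rho) * (1 - t `^ (beta - rho)))%:E * k (side R b, side R b * t)%R)%E.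
pose g a := (expR (- beta / 2 * a) *
  ((1 - expR (rho * a)) * (1 - expR ((beta - rho) * a))) * n b b a)%:E.
change (\int[mu]_(t in `]0%R, 1%R[) f t = 2^-1%:E * \int[mu]_a g a)%E.
have mf : measurable_fun setT f.
  apply: emeasurable_funM; last exact: measurable_kernel_side.
  apply/measurable_EFinP; apply: measurable_funM; apply: measurable_funB => //;
    exact: measurable_powR.
have f0 t : (0 <= f t)%E.
  apply: mule_ge0; last exact: (kernel_ge0 hk).
  by rewrite lee_fin onem_powR_ge0.
have mg : measurable_fun setT g.
  apply/measurable_EFinP; apply: measurable_funM; last exact: (measurable_log_kernel hk b b).
  apply: measurable_funM; first exact: measurable_expRM.
  by apply: measurable_funM; apply: measurable_funB => //; exact: measurable_expRM.
have g0 a : (0 <= g a)%E.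
  rewrite lee_fin mulr_ge0 ?(log_kernel_ge0 hk)// mulr_ge0 ?expR_ge0// onem_expR_ge0//.
  by rewrite mulrACA mulr_ge0// -expr2 sqr_ge0.
have gN a : g (- a) = g a by rewrite /g even_weight (log_kernelN hk).
rewrite (ge0_integral_expR_itv01 mf f0) (ge0_integral_even mg g0 gN).
rewrite muleA -EFinM mulVf// mul1e; apply: eq_integral => z.
(* [z < 0] stays off the diagonal, so [kernel_side_expR] applies although both points lie on the
   same side. *)
rewrite inE/= in_itv/= => z0.
rewrite /f -muleA kernel_side_expR ?(lt_eqF z0) ?orbT// -EFinM -!expRM /g.
by rewrite ![z * _]mulrC; congr EFin; ring.
Qed.

Lemma cross_momentE b rho :
  (\int[mu]_(t in `]0%R, +oo[) ((t `^ rho)%:E * k (side R b, side R (~~ b) * t)%R))%E =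
  (\int[mu]_a (expR ((rho - beta / 2) * a) * n b (~~ b) a)%:E)%E.
Proof.
rewrite ge0_integral_expR; last 2 first.
- apply: emeasurable_funM; last exact: measurable_kernel_side.
  by apply/measurable_EFinP; exact: measurable_powR.
- by move=> t; rewrite mule_ge0 ?(kernel_ge0 hk)// lee_fin powR_ge0.
apply: eq_integral => z _.
rewrite -muleA kernel_side_expR; last by case: b.
rewrite -EFinM -expRM mulrA -expRD.
by congr ((expR _ * _)%:E); ring.
Qed.

(** Passing from [beta / p] to [beta / q] only swaps the two factors, so the two gamma terms
    averaged in [D_pos] or [D_neg] coincide. *)
Lemma gamma_diag b rho : rho = beta / p \/ rho = beta / q ->
  fine (\int[mu]_(t in `]0%R, 1%R[)
    (((1 - t `^ rho) * (1 - t `^ (beta - rho)))%:E *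
     k (side R b, side R b * t)%R))%E = 2^-1 * diag_integral b.
Proof.
move=> hrho.
have hrho' : (rho = beta / p /\ beta - rho = beta / q) \/
    (rho = beta / q /\ beta - rho = beta / p).
  have e : beta / p + beta / q = beta by rewrite -mulrDr pq1 mulr1.
  by case: hrho => ->; [left|right]; split => //; rewrite -{1}e; ring.
have b0 : 0 <= beta / p * (beta / q).
  by rewrite mulrACA mulr_ge0 -?expr2 ?sqr_ge0// mulr_ge0// invr_ge0 ltW.
rewrite gammaE; last first.
  by case: hrho' => -[-> ->]; rewrite // mulrC.
have -> : (\int[mu]_a (expR (- beta / 2 * a) * ((1 - expR (rho * a)) *
    (1 - expR ((beta - rho) * a))) * n b b a)%:E =
    \int[mu]_a (diag_weight a * n b b a)%:E)%E.
  apply: eq_integral => a _; rewrite /diag_weight.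
  by case: hrho' => -[-> ->] //; congr ((_ * _ * _)%:E); rewrite mulrC.
by rewrite fineM// (integrable_fin_num _ (integrable_diag b)).
Qed.

Lemma cross_moment_powR b rho :
  fine (\int[mu]_(t in `]0%R, +oo[) ((t `^ rho)%:E * k (side R b, side R (~~ b) * t)%R))%E
  = cross_moment b (rho - beta / 2).
Proof. by rewrite cross_momentE. Qed.

Lemma cross_moment_kernel b :
  fine (\int[mu]_(t in `]0%R, +oo[) k (side R b, side R (~~ b) * t)%R)%E
  = cross_moment b (- beta / 2).
Proof.
rewrite mulNr -[- (beta / 2)]add0r -cross_moment_powR.
by congr fine; apply: eq_integral => t _; rewrite powRr0 mul1e.
Qed.

Lemma side_ratio_powR : side_ratio true `^ (p - 1) = s `^ q^-1.
Proof.
by rewrite /side_ratio -powRrM; congr (_ `^ _); rewrite /conj_exp invf_div mulrC.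
Qed.

Lemma D_posE : D_pos alpha k p s beta = 2^-1 * diag_integral true + cross_integral true.
Proof.
have G rho : rho = beta / p \/ rho = beta / q ->
    gamma_pos alpha k rho = 2^-1 * diag_integral true.
  move=> h; rewrite -(gamma_diag true h) /gamma_pos; congr fine.
  by apply: eq_integral => t _; rewrite /side mul1r.
rewrite /D_pos /C_pos /= !G; [|by left|by right].
have -> : (\int[mu]_(t in `]0%R, +oo[) k (1, - t)%R =
    \int[mu]_(t in `]0%R, +oo[) k (side R true, side R false * t)%R)%E.
  by apply: eq_integral => t _; rewrite /side mulN1r.
rewrite (cross_moment_kernel true).
have M rho : (\int[mu]_(t in `]0%R, +oo[) ((t `^ rho)%:E * k (1, - t)%R) =
    \int[mu]_(t in `]0%R, +oo[) ((t `^ rho)%:E * k (side R true, side R false * t)%R))%E.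
  by apply: eq_integral => t _; rewrite /side mulN1r.
rewrite /cross_integral side_ratio_powR !M !(cross_moment_powR true) /side_ratio.
move: (diag_integral true) (cross_moment true _) (cross_moment true _) (cross_moment true _).
move: (s `^ p^-1) (s `^ q^-1) => r1 r2 x y z w.
(* The terms common to both constants [C_pos] carry total weight [p^-1 + q^-1 = 1]. *)
by rewrite -[X in _ = X + _]mul1r -[X in _ = _ + (X - _ - _)]mul1r -pq1; ring.
Qed.

Lemma D_negE : D_neg alpha k p s beta = 2^-1 * diag_integral false + cross_integral false.
Proof.
have G rho : rho = beta / p \/ rho = beta / q ->
    gamma_neg alpha k rho = 2^-1 * diag_integral false.
  move=> h; rewrite -(gamma_diag false h) /gamma_neg; congr fine.
  by apply: eq_integral => t _; rewrite /side mulN1r.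
rewrite /D_neg /C_neg /= !G; [|by left|by right].
have -> : (\int[mu]_(t in `]0%R, +oo[) k (- 1, t)%R =
    \int[mu]_(t in `]0%R, +oo[) k (side R false, side R true * t)%R)%E.
  by apply: eq_integral => t _; rewrite /side mul1r.
rewrite (cross_moment_kernel false).
have M rho : (\int[mu]_(t in `]0%R, +oo[) ((t `^ rho)%:E * k (- 1, t)%R) =
    \int[mu]_(t in `]0%R, +oo[) ((t `^ rho)%:E * k (side R false, side R true * t)%R))%E.
  by apply: eq_integral => t _; rewrite /side mul1r.
have rE : side_ratio false `^ (p - 1) = (s `^ q^-1)^-1.
  rewrite -side_ratio_powR /side_ratio -(powR_inv1 (powR_ge0 s p^-1)).
  by rewrite -(powR_inv1 (powR_ge0 (s `^ p^-1) (p - 1))) powRAC.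
rewrite /cross_integral rE !M !(cross_moment_powR false) /side_ratio.
move: (diag_integral false) (cross_moment false _) (cross_moment false _) (cross_moment false _).
move: (s `^ p^-1) (s `^ q^-1) => r1 r2 x y z w.
by rewrite -[X in _ = X + _]mul1r -[X in _ = _ + (X - _ - _)]mul1r -pq1; ring.
Qed.

End constants.

(** The minorant [f] may change sign and the integral of [g] may be infinite; in the latter case
    there is nothing to prove. *)
Lemma le_integral_ge0r d (T : measurableType d) (R : realType)
    (mu : {measure set T -> \bar R}) (f g : T -> \bar R) :
  mu.-integrable setT f -> measurable_fun setT g -> (forall x, 0 <= g x)%E ->
  (forall x, f x <= g x)%E -> (\int[mu]_x f x <= \int[mu]_x g x)%E.
Proof.
move=> intf mg g0 fg; have [goo|goo] := ltP (\int[mu]_x g x)%E +oo%E.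
  apply: le_integral => //; apply/integrableP; split => //.
  by under eq_integral do rewrite gee0_abs//.
by move: goo; rewrite leye_eq => /eqP ->; rewrite leey.
Qed.

Section linear_combination.
Context d (T : measurableType d) (R : realType) (mu : {measure set T -> \bar R}).
Implicit Types (f g : T -> R) (c e : R).

Lemma EFin_Rintegral f : mu.-integrable setT (EFin \o f) ->
  (\int[mu]_x f x)%:E = (\int[mu]_x (f x)%:E)%E.
Proof. by move=> intf; rewrite fineK//; exact: integrable_fin_num intf. Qed.

Lemma integrable_lincomb c e f g :
  mu.-integrable setT (EFin \o f) -> mu.-integrable setT (EFin \o g) ->
  mu.-integrable setT (EFin \o (fun x => c * f x + e * g x)).
Proof.
move=> intf intg.
apply: eq_integrable (integrableD measurableT (integrableZl measurableT c intf)
  (integrableZl measurableT e intg)) => // x _ /=.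
Qed.

Lemma integral_lincomb c e f g :
  mu.-integrable setT (EFin \o f) -> mu.-integrable setT (EFin \o g) ->
  (\int[mu]_x (c * f x + e * g x)%:E)%E =
  (c * (\int[mu]_x f x) + e * (\int[mu]_x g x))%:E.
Proof.
move=> intf intg.
transitivity (\int[mu]_x (c%:E * (EFin \o f) x + e%:E * (EFin \o g) x))%E.
  by apply: eq_integral => x _.
rewrite (integralD measurableT (integrableZl measurableT c intf)
  (integrableZl measurableT e intg)).
by rewrite !integralZl// EFinD !EFinM !EFin_Rintegral.
Qed.

End linear_combination.

Lemma integrable_oppr (R : realType) (f : R -> \bar R) :
  (@lebesgue_measure R).-integrable setT f ->
  (@lebesgue_measure R).-integrable setT (fun x : R => f (- x)).
Proof.
move=> /integrableP[mf fc].
have mN : measurable_fun setT (fun x : R => f (- x)).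
  by apply: (measurableT_comp mf); exact: oppr_measurable.
apply/integrableP; split; first exact: mN.
by rewrite (integral_oppr (f := abse \o f))//; exact: measurableT_comp.
Qed.

(** * Test functions supported away from the origin *)

Section punctured_support.
Context {R : realType} (u : R -> R).
Hypothesis hu : Cc_punctured u.

Lemma Cc_punctured_measurable : measurable_fun setT u.
Proof. by case: hu => cu _ _; exact: continuous_measurable_fun. Qed.

(** A compact support avoiding 0 stays away from both 0 and infinity, so in the coordinate [z] it is
    bounded in both directions. *)
Lemma Cc_punctured_support : exists L : R, forall b z,
  L < `|z| -> u (side R b * expR z) = 0.
Proof.
case: hu => cu cK K0; set S := [set x | u x != 0] in cK K0.
have n0 : nbhs (0 : R) (~` closure S).
  apply: open_nbhs_nbhs; split; first exact/closed_openC/closed_closure.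
  by move=> /K0 /=; apply.
have [e /= e0 he] := (nbhs_ballP _ _).1 n0.
have [M [_ hM]] := compact_bounded cK.
have uM x : `|M| + 1 < `|x| -> u x = 0.
  move=> hx; apply/eqP; apply: contraPT hx => ux; apply/negP; rewrite -leNgt.
  apply: (hM (`|M| + 1)); first by rewrite (le_lt_trans (ler_norm _))// ltrDl.
  exact: subset_closure.
have ue x : `|x| < e -> u x = 0.
  move=> hx; apply/eqP; apply: contraPT hx => ux hx.
  by apply: (he x); [rewrite /ball/= sub0r normrN|exact: subset_closure].
have M1 : 0 < `|M| + 1 by rewrite ltr_wpDl.
exists (Num.max (ln (`|M| + 1)) (- ln e)) => b z; rewrite gt_max => /andP[h1 h2].
have nE : `|side R b * expR z| = expR z by rewrite normrM norm_side mul1r ger0_norm ?expR_ge0.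
have [z0|z0] := leP 0 z.
  by apply: uM; rewrite nE -(@lnK _ (`|M| + 1)) ?posrE// ltr_expR -(ger0_norm z0).
by apply: ue; rewrite nE -(@lnK _ e) ?posrE// ltr_expR -ltrN2 -(ltr0_norm z0).
Qed.

Lemma Cc_punctured_bounded : exists B : R, forall x, `|u x| <= B.
Proof.
case: hu => cu cK K0; set S := [set x | u x != 0] in cK K0.
have /compact_bounded[M [_ hM]] : compact (u @` closure S).
  by apply: continuous_compact => //; exact: continuous_subspaceT.
exists (`|M| + 1) => x; have [->|ux] := eqVneq (u x) 0.
  by rewrite normr0 addr_ge0.
apply: (hM (`|M| + 1)); first by rewrite (le_lt_trans (ler_norm _))// ltrDl.
by exists x => //; exact: subset_closure.
Qed.

End punctured_support.

(** * The Hardy inequality *)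

Section lower_bound.
Context {R : realType} (alpha p s : R) (k : R * R -> \bar R).
Hypotheses (halpha : 0 < alpha < 2) (hp : 1 < p) (hs : 0 < s).
Hypothesis hk : kernel_class alpha k.
Local Notation n := (log_kernel k).
Local Notation mu := (@lebesgue_measure R).
Local Notation beta := (alpha - 1).
Local Notation q := (conj_exp p).
Implicit Types (b d : bool) (a z c r : R).

Let p0 : 0 < p. Proof. by rewrite (lt_trans _ hp). Qed.
Let q0 : 0 < q. Proof. by rewrite (lt_trans _ (conj_exp_gt1 hp)). Qed.
Let pq1 : p^-1 + q^-1 = 1. Proof. exact: conj_expE. Qed.

(** The Young coefficient for the ground-state ratio [r * expR (beta / p * a)], together with the
    [a]-part of the factor [expR (- beta * (z + a / 2))] of the energy. *)
Definition ratio_weight r a : R :=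
  expR (- beta / 2 * a) * young_weight p (r * expR (beta / p * a)).

Lemma ratio_weightE r a : 0 < r -> ratio_weight r a =
  expR (- beta / 2 * a)
  - p^-1 * r `^ (p - 1) * expR ((beta / q - beta / 2) * a)
  - q^-1 * r * expR ((beta / p - beta / 2) * a).
Proof.
move=> r0; rewrite /ratio_weight /young_weight powRM ?expR_ge0 ?(ltW r0)//.
rewrite -expRM (_ : beta / p * a * (p - 1) = beta / q * a); last first.
  by rewrite /conj_exp; field; rewrite subr_eq0 !gt_eqF.
have e t : (beta / t - beta / 2) * a = - beta / 2 * a + beta / t * a by ring.
by rewrite !e !expRD; ring.
Qed.

(** The cancellation on one half-line: for [beta != 0] each summand vanishes only to first order at
    [a = 0], the sum to second order. *)
Lemma ratio_weight1D a :
  ratio_weight 1 a + ratio_weight 1 (- a) = diag_weight alpha p a.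
Proof.
rewrite !ratio_weightE// powR1 !mulr1.
have e1 : beta / p = beta - beta / q.
  by rewrite (_ : p^-1 = 1 - q^-1); [ring|rewrite -pq1; ring].
have -> : (beta / q - beta / 2) * - a = (beta / p - beta / 2) * a.
  by rewrite e1; field; rewrite gt_eqF.
have -> : (beta / p - beta / 2) * - a = (beta / q - beta / 2) * a.
  by rewrite e1; field; rewrite gt_eqF.
have -> : - beta / 2 * - a = - beta / 2 * a + (beta / p * a + beta / q * a).
  by rewrite e1; field; rewrite gt_eqF.
have e t : (beta / t - beta / 2) * a = - beta / 2 * a + beta / t * a by ring.
rewrite /diag_weight !e !expRD; have -> : q^-1 = 1 - p^-1 by rewrite -pq1; ring.
by ring.
Qed.

Definition pair_ratio b d : R := if b == d then 1 else side_ratio p s b.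

Lemma pair_ratio_gt0 b d : 0 < pair_ratio b d.
Proof. by rewrite /pair_ratio; case: ifP => // _; exact: side_ratio_gt0. Qed.

Lemma pair_ratioV b d : (pair_ratio b d)^-1 = pair_ratio d b.
Proof.
rewrite /pair_ratio eq_sym; case: eqP => [_|]; first by rewrite invr1.
by case: b d => [] [] // _; rewrite /side_ratio ?invrK.
Qed.

(** The density [|u|^p * |x|^(-alpha) dx] on side [b]; the Jacobian turns [- alpha] into
    [- beta]. *)
Definition log_mass (u : R -> R) b z : R :=
  `|u (side R b * expR z)| `^ p * expR (- beta * z).

Lemma log_mass_ge0 u b z : 0 <= log_mass u b z.
Proof. by rewrite mulr_ge0 ?powR_ge0 ?expR_ge0. Qed.

(** The factor centred at [z + a / 2] is split once around [z] and once around [z + a], so the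
    second term is the first with the endpoints exchanged and [a] reversed. *)
Lemma log_mass_ratio_weight u b d a z :
  expR (- beta * (z + a / 2)) *
    (`|u (side R b * expR z)| `^ p *
       young_weight p (pair_ratio b d * expR (beta / p * a)) +
     `|u (side R d * expR (z + a))| `^ p *
       young_weight p (pair_ratio b d * expR (beta / p * a))^-1) =
  log_mass u b z * ratio_weight (pair_ratio b d) a +
  log_mass u d (z + a) * ratio_weight (pair_ratio d b) (- a).
Proof.
rewrite /log_mass /ratio_weight mulrDr.
rewrite [(pair_ratio b d * _)^-1]invfM pair_ratioV -expRN.
rewrite (_ : - (beta / p * a) = beta / p * - a); last by ring.
have -> : expR (- beta * (z + a / 2)) = expR (- beta * z) * expR (- beta / 2 * a).
  by rewrite -expRD; congr expR; field.
have e : expR (- beta * z) * expR (- beta / 2 * a) =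
    expR (- beta * (z + a)) * expR (- beta / 2 * - a).
  by rewrite -!expRD; congr expR; field.
by rewrite [in X in _ + X = _]e; ring.
Qed.

Lemma log_energy_ge u b d a z :
  log_mass u b z * ratio_weight (pair_ratio b d) a +
  log_mass u d (z + a) * ratio_weight (pair_ratio d b) (- a)
  <= log_energy alpha p u b d a z.
Proof.
have l0 : 0 < pair_ratio b d * expR (beta / p * a).
  by rewrite mulr_gt0 ?expR_gt0 ?pair_ratio_gt0.
rewrite -log_mass_ratio_weight.
exact: (ler_wpM2l (expR_ge0 _) (energy_gap_ge _ _ hp l0)).
Qed.

Section test_function.
Variable u : R -> R.
Hypothesis hu : Cc_punctured u.
Let mu' : measurable_fun setT u. Proof. exact: Cc_punctured_measurable. Qed.

Lemma measurable_log_mass b : measurable_fun setT (log_mass u b).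
Proof.
apply: measurable_funM; last exact: measurable_expRM.
apply: (measurableT_comp (measurable_powR p)).
apply: measurableT_comp => //; apply: (measurableT_comp mu').
exact: measurable_funM.
Qed.

Lemma integrable_log_mass b : mu.-integrable setT (EFin \o log_mass u b).
Proof.
have [L hL] := Cc_punctured_support hu; have [B hB] := Cc_punctured_bounded hu.
have B0 : 0 <= B := le_trans (normr_ge0 _) (hB 0).
have hI := integrable_indic_itv (- L) L true false.
apply: (le_integrable _ _ _ (integrableZl measurableT (B `^ p * expR (`|beta| * L)) hI)) => //=.
  by apply/measurable_EFinP; exact: measurable_log_mass.
move=> z _; rewrite lee_fin ger0_norm ?log_mass_ge0// indicE.
have C0 : 0 <= B `^ p * expR (`|beta| * L) by rewrite mulr_ge0 ?powR_ge0 ?expR_ge0.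
rewrite ger0_norm; last by apply: mulr_ge0.
have [zL|Lz] := leP `|z| L; last first.
  by rewrite /log_mass hL// normr0 powR0 ?gt_eqF// mul0r mulr_ge0.
rewrite mem_set ?mulr1; last by rewrite /= in_itv/= -ler_norml.
rewrite /log_mass; apply: ler_pM; rewrite ?powR_ge0 ?expR_ge0//.
  by rewrite ge0_ler_powR ?nnegrE// ltW.
by rewrite ler_expR (le_trans (ler_norm _))// normrM normrN ler_wpM2l.
Qed.

Definition mass b : R := (\int[mu]_z log_mass u b z)%R.

Lemma mass_EFin b : (mass b)%:E = (\int[mu]_z (log_mass u b z)%:E)%E.
Proof. by rewrite fineK//; exact: integrable_fin_num (integrable_log_mass b). Qed.

Lemma integral_log_mass_translate b a :
  (\int[mu]_z (log_mass u b (z + a))%:E = (mass b)%:E)%E.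
Proof.
rewrite mass_EFin -(ge0_integral_translate a (f := EFin \o log_mass u b)).
- by apply: eq_integral => z _ /=; rewrite addrC.
- by apply/measurable_EFinP; exact: measurable_log_mass.
- by move=> z; rewrite lee_fin log_mass_ge0.
Qed.

Lemma integrable_log_mass_translate b a :
  mu.-integrable setT (fun z => (log_mass u b (z + a))%:E).
Proof.
have m1 : measurable_fun setT (fun z => log_mass u b (z + a)).
  by apply: (measurableT_comp (measurable_log_mass b)); exact: measurable_funD.
apply/integrableP; split; first exact/measurable_EFinP.
under eq_integral do rewrite gee0_abs ?lee_fin ?log_mass_ge0//.
by rewrite integral_log_mass_translate ltry.
Qed.

Definition main_weight b d a : R :=
  mass b * ratio_weight (pair_ratio b d) a +
  mass d * ratio_weight (pair_ratio d b) (- a).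

Lemma integrable_log_masses b d a c1 c2 : mu.-integrable setT
  (fun z => (log_mass u b z * c1 + log_mass u d (z + a) * c2)%:E).
Proof.
have h1 := integrableZl measurableT c1 (integrable_log_mass b).
have h2 := integrableZl measurableT c2 (integrable_log_mass_translate d a).
apply: eq_integrable (integrableD measurableT h1 h2) => // z _ /=.
by rewrite -EFinD ![c1 * _]mulrC ![c2 * _]mulrC.
Qed.

Lemma integral_log_masses b d a c1 c2 :
  (\int[mu]_z (log_mass u b z * c1 + log_mass u d (z + a) * c2)%:E =
   (mass b * c1 + mass d * c2)%:E)%E.
Proof.
have h1 := integrableZl measurableT c1 (integrable_log_mass b).
have h2 := integrableZl measurableT c2 (integrable_log_mass_translate d a).
transitivity (\int[mu]_z (c1%:E * (EFin \o log_mass u b) z + c2%:E * (log_mass u d (z + a))%:E))%E.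
  by apply: eq_integral => z _ /=; rewrite -EFinD ![c1 * _]mulrC ![c2 * _]mulrC.
rewrite (integralD measurableT h1 h2) integralZl//; last exact: integrable_log_mass.
rewrite integralZl//; last exact: integrable_log_mass_translate.
transitivity (c1%:E * (mass b)%:E + c2%:E * (mass d)%:E)%E.
  congr (_ * _ + _ * _)%E; first by rewrite mass_EFin.
  exact: integral_log_mass_translate.
by rewrite -EFinM -EFinM -EFinD (mulrC c1) (mulrC c2).
Qed.

Lemma measurable_log_energy1 b d a : measurable_fun setT (log_energy alpha p u b d a).
Proof.
exact: (measurable_fun_pair1 a (measurable_log_energy alpha p b d mu')).
Qed.

(** At fixed [a] the coefficients and the kernel are constants, and both masses are finite and
    translation invariant. *)
Lemma inner_log_energy_ge b d a :
  ((main_weight b d a * n b d a)%:E <=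
   \int[mu]_z (log_energy alpha p u b d a z * n b d a)%:E)%E.
Proof.
have n0 := log_kernel_ge0 hk b d a.
have := @log_energy_ge u b d a; rewrite /main_weight.
move: (ratio_weight _ a) (ratio_weight _ (- a)) => w1 w2 h.
have -> : (mass b * w1 + mass d * w2) * n b d a =
  mass b * (w1 * n b d a) + mass d * (w2 * n b d a) by ring.
rewrite -(integral_log_masses b d a).
apply: le_integral_ge0r.
- exact: integrable_log_masses.
- by apply/measurable_EFinP; apply: measurable_funM => //; exact: measurable_log_energy1.
- by move=> z; rewrite lee_fin mulr_ge0// log_energy_ge0.
- by move=> z; rewrite lee_fin !mulrA -mulrDl ler_wpM2r// h.
Qed.

Definition main_integral b d : R :=
  if b == d then mass b * diag_integral alpha p k b
  else mass b * cross_integral alpha p s k b + mass d * cross_integral alpha p s k d.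

Let cross b c a : R := expR (c * a) * n b (~~ b) a.

(** The factors 1 arrange three terms as nested two-term combinations, the form handled by
    [integrable_lincomb] and [integral_lincomb]. *)
Let cross_comb b a :
  ratio_weight (side_ratio p s b) a * n b (~~ b) a =
  1 * (1 * cross b (- beta / 2) a +
       - (p^-1 * side_ratio p s b `^ (p - 1)) * cross b (beta / q - beta / 2) a) +
  - (q^-1 * side_ratio p s b) * cross b (beta / p - beta / 2) a.
Proof. by rewrite ratio_weightE ?side_ratio_gt0// /cross; ring. Qed.

Let i1 b : mu.-integrable setT (EFin \o cross b (- beta / 2)).
Proof. exact: integrable_cross (norm_half_betaN alpha). Qed.

Let i2 b : mu.-integrable setT (EFin \o cross b (beta / q - beta / 2)).
Proof. exact: integrable_cross (norm_exponent alpha (conj_exp_gt1 hp)). Qed.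

Let i3 b : mu.-integrable setT (EFin \o cross b (beta / p - beta / 2)).
Proof. exact: integrable_cross (norm_exponent alpha hp). Qed.

Let cross_ratio b a := ratio_weight (side_ratio p s b) a * n b (~~ b) a.

Let integrable_cross_ratio b : mu.-integrable setT (EFin \o cross_ratio b).
Proof.
have h := integrable_lincomb 1 (- (q^-1 * side_ratio p s b))
  (integrable_lincomb 1 (- (p^-1 * side_ratio p s b `^ (p - 1))) (@i1 b) (@i2 b)) (@i3 b).
by apply: eq_integrable h => // a _ /=; rewrite /cross_ratio cross_comb.
Qed.

Let integral_cross_ratio b :
  (\int[mu]_a cross_ratio b a)%R = cross_integral alpha p s k b.
Proof.
apply: EFin_inj; rewrite EFin_Rintegral; last exact: integrable_cross_ratio.
under eq_integral do rewrite /cross_ratio cross_comb.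
rewrite (integral_lincomb _ _ (integrable_lincomb 1
  (- (p^-1 * side_ratio p s b `^ (p - 1))) (@i1 b) (@i2 b)) (@i3 b)).
rewrite mul1r; congr (_ + _)%:E; last by rewrite mulNr.
apply: EFin_inj; rewrite EFin_Rintegral; last exact: integrable_lincomb.
rewrite (integral_lincomb _ _ (@i1 b) (@i2 b)).
by congr (_ + _)%:E; [rewrite mul1r|rewrite mulNr].
Qed.

(** Reversing [a] exchanges the endpoints: the coefficient of the far mass is a reflected near-side
    coefficient, with the same integral as before reflection. *)
Let cross_ratioN b a : cross_ratio (~~ b) (- a) =
  ratio_weight (side_ratio p s (~~ b)) (- a) * n b (~~ b) a.
Proof. by rewrite /cross_ratio negbK (log_kernelN hk). Qed.

Let integrable_cross_ratioN b :
  mu.-integrable setT (EFin \o (fun a => cross_ratio b (- a))).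
Proof.
exact: (integrable_oppr (integrable_cross_ratio b)).
Qed.

Let integral_cross_ratioN b : (\int[mu]_a cross_ratio b (- a))%R = cross_integral alpha p s k b.
Proof.
rewrite -integral_cross_ratio /Rintegral (integral_oppr (f := EFin \o cross_ratio b))//.
by have /integrableP[] := integrable_cross_ratio b.
Qed.

Let main_weight_diag b a : main_weight b b a * n b b a =
  mass b * (diag_weight alpha p a * n b b a).
Proof.
by rewrite /main_weight -mulrDr -mulrA /pair_ratio eqxx ratio_weight1D.
Qed.

Let main_weight_cross b a : main_weight b (~~ b) a * n b (~~ b) a =
  mass b * cross_ratio b a + mass (~~ b) * cross_ratio (~~ b) (- a).
Proof.
rewrite cross_ratioN /cross_ratio /main_weight /pair_ratio.
by case: b => /=; ring.
Qed.

Lemma integrable_main_weight b d :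
  mu.-integrable setT (EFin \o (fun a => main_weight b d a * n b d a)).
Proof.
have [<-|bd] := eqVneq b d.
  apply: eq_integrable (integrableZl measurableT (mass b)
    (integrable_diag halpha hp hk b)) => // a _ /=.
  by rewrite main_weight_diag.
have -> : d = ~~ b by case: b d bd => [] [].
apply: eq_integrable (integrable_lincomb (mass b) (mass (~~ b))
  (integrable_cross_ratio b) (integrable_cross_ratioN (~~ b))) => // a _ /=.
by rewrite main_weight_cross.
Qed.

Lemma integral_main_weight b d :
  (\int[mu]_a (main_weight b d a * n b d a)%:E = (main_integral b d)%:E)%E.
Proof.
rewrite /main_integral; have [<-|bd] := eqVneq b d.
  under eq_integral do rewrite main_weight_diag EFinM.
  rewrite (integralZl measurableT (integrable_diag halpha hp hk b)).
  by rewrite EFinM (EFin_Rintegral (integrable_diag halpha hp hk b)).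
have -> : d = ~~ b by case: b d bd => [] [].
under eq_integral do rewrite main_weight_cross.
rewrite (integral_lincomb _ _ (integrable_cross_ratio b) (integrable_cross_ratioN (~~ b))).
by rewrite integral_cross_ratio integral_cross_ratioN.
Qed.

Lemma log_energy_integral_ge b d :
  ((main_integral b d)%:E <= log_energy_integral alpha p k u b d)%E.
Proof.
rewrite -integral_main_weight; apply: le_integral_ge0r.
- exact: integrable_main_weight.
- apply: (measurable_fun_fubini_tonelli_G (m1 := mu)
   (fun x : R * R => (log_energy alpha p u b d x.2 x.1 * n b d x.2)%:E)).
    apply/measurable_EFinP; apply: measurable_funM; first exact: measurable_log_energy.
    by apply: (measurableT_comp (measurable_log_kernel hk b d)).
  by move=> x; rewrite lee_fin mulr_ge0 ?log_energy_ge0 ?(log_kernel_ge0 hk).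
- by move=> a; apply: integral_ge0 => z _; rewrite lee_fin mulr_ge0 ?log_energy_ge0 ?(log_kernel_ge0 hk).
- exact: inner_log_energy_ge.
Qed.

(** Each side's cross integral occurs in both mixed pairs and its diagonal integral once; the factor
    [2^-1] of the energy then matches [D_posE] and [D_negE]. *)
Lemma sum_main_integral :
  2^-1 * ((main_integral true true + main_integral true false) +
          (main_integral false true + main_integral false false)) =
  mass true * D_pos alpha k p s beta + mass false * D_neg alpha k p s beta.
Proof.
rewrite (D_posE s halpha hp hk) (D_negE s halpha hp hk) /main_integral /=.
by field.
Qed.

Lemma energy_ge :
  ((mass true * D_pos alpha k p s beta + mass false * D_neg alpha k p s beta)%:E
   <= energy k p u)%E.
Proof.
rewrite (energy_log hp hk mu') -sum_main_integral.
have := log_energy_integral_ge; move: main_integral => M h.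
by rewrite EFinM !EFinD lee_wpmul2l ?lee_fin ?invr_ge0// !leeD.
Qed.

Definition side_density b x : R :=
  if 0 < side R b * x then `|u x| `^ p * `|x| `^ (- alpha) else 0.

Lemma side_density_ge0 b x : 0 <= side_density b x.
Proof. by rewrite /side_density; case: ifP => // _; rewrite mulr_ge0 ?powR_ge0. Qed.

Lemma measurable_side_density b : measurable_fun setT (side_density b).
Proof.
apply: measurable_fun_ifT => //.
  by apply: measurable_fun_ltr => //; exact: measurable_funM.
apply: measurable_funM.
  apply: (measurableT_comp (measurable_powR p)); exact: measurableT_comp.
by apply: (measurableT_comp (measurable_powR (- alpha))); exact: normr_measurable.
Qed.

Lemma integral_side_density b :
  (\int[mu]_x (side_density b x)%:E = (mass b)%:E)%E.
Proof.
have md : measurable_fun setT (EFin \o side_density b).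
  by apply/measurable_EFinP; exact: measurable_side_density.
rewrite (ge0_integral_expR_sum md); last by move=> x; rewrite lee_fin side_density_ge0.
have same z : ((side_density b (side R b * expR z)%R)%:E * (expR z)%:E)%E = (log_mass u b z)%:E.
  rewrite /side_density mulrA -expr2.
  have -> : side R b ^+ 2 = 1 by case: b {md}; rewrite /side ?sqrrN expr1n.
  rewrite mul1r expR_gt0 -EFinM; congr EFin; rewrite /log_mass -mulrA; congr (_ * _).
  rewrite normrM norm_side mul1r ger0_norm ?expR_ge0// -expRM -expRD; congr expR; ring.
have other z : ((side_density b (side R (~~ b) * expR z)%R)%:E * (expR z)%:E)%E = 0%E.
  rewrite /side_density mulrA.
  have -> : side R b * side R (~~ b) = -1 by case: b {md same}; rewrite /side/= ?mulN1r ?mul1r.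
  by rewrite mulN1r oppr_gt0 ltNge expR_ge0/= mul0e.
rewrite mass_EFin; have e1 z : expR z = side R true * expR z by rewrite /side mul1r.
have e2 z : - expR z = side R false * expR z by rewrite /side mulN1r.
case: b md same other => md same other.
  rewrite [X in (_ + X)%E]integral0_eq ?adde0.
    by apply: eq_integral => z _; rewrite -same -e1.
  by move=> z _; rewrite e2 other.
rewrite [X in (X + _)%E]integral0_eq ?add0e.
  by apply: eq_integral => z _; rewrite -same -e2.
by move=> z _; rewrite {1}e1 other.
Qed.

Lemma integrable_side_density b : mu.-integrable setT (EFin \o side_density b).
Proof.
apply/integrableP; split.
  by apply/measurable_EFinP; exact: measurable_side_density.
under eq_integral do rewrite gee0_abs ?lee_fin ?side_density_ge0//.
by rewrite integral_side_density ltry.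
Qed.

Lemma Rintegral_side_density b : (\int[mu]_x side_density b x)%R = mass b.
Proof. by rewrite /Rintegral integral_side_density. Qed.

Let weight_density x : `|u x| `^ p * weight alpha k p s x =
  D_pos alpha k p s beta * side_density true x +
  D_neg alpha k p s beta * side_density false x.
Proof.
rewrite /weight /side_density /side mul1r mulN1r oppr_gt0.
by case: (ltgtP x 0) => h; ring.
Qed.

Lemma integral_weight :
  (\int[mu]_x (`|u x| `^ p * weight alpha k p s x)%:E)%E =
  (mass true * D_pos alpha k p s beta + mass false * D_neg alpha k p s beta)%:E.
Proof.
under eq_integral do rewrite weight_density.
rewrite (integral_lincomb _ _ (integrable_side_density true) (integrable_side_density false)).
by rewrite !Rintegral_side_density ![mass _ * _]mulrC.
Qed.

End test_function.

Lemma measurable_weight : measurable_fun setT (weight alpha k p s).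
Proof.
have mw (D : R) : measurable_fun setT (fun x : R => `|x| `^ (- alpha) * D).
  apply: measurable_funM => //.
  by apply: (measurableT_comp (measurable_powR (- alpha))); exact: normr_measurable.
apply: measurable_fun_ifT => //; first exact: measurable_fun_ltr.
by apply: measurable_fun_ifT => //; exact: measurable_fun_ltr.
Qed.

Lemma locally_integrable_weight : locally_integrable [set~ 0] (weight alpha k p s).
Proof.
split.
- by apply: measurable_funTS; exact: measurable_weight.
- by apply: closed_openC; exact: closed_eq.
move=> K K0 cK.
have mK : measurable K by exact: compact_measurable.
have n0 : nbhs (0 : R) (~` K).
  apply: open_nbhs_nbhs; split; last by move=> /K0 /=; apply.
  by apply: closed_openC; exact: compact_closed.
have [e /= e0 he] := (nbhs_ballP _ _).1 n0.
have Ke x : K x -> e <= `|x|.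
  move=> Kx; rewrite leNgt; apply/negP => xe; apply: (he x) => //.
  by rewrite /ball/= sub0r normrN.
pose M := e `^ (- alpha) * (`|D_pos alpha k p s beta| + `|D_neg alpha k p s beta|).
apply: (@le_lt_trans _ _ (M%:E * mu K)%E); last first.
  rewrite lte_mul_pinfty ?lee_fin ?mulr_ge0 ?powR_ge0 ?addr_ge0//.
  exact: compact_finite_measure.
change (\int[mu]_(x in K) `|(EFin \o weight alpha k p s) x| <= M%:E * mu K)%E.
apply: integral_le_bound => //.
- by apply: measurable_funTS; apply/measurable_EFinP; exact: measurable_weight.
- by rewrite lee_fin mulr_ge0 ?powR_ge0 ?addr_ge0.
apply: aeW => x Kx /=; rewrite lee_fin.
have le_xe : `|x| `^ (- alpha) <= e `^ (- alpha).
  have x0 := lt_le_trans e0 (Ke x Kx).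
  rewrite !powRN lef_pV2 ?posrE ?powR_gt0// ge0_ler_powR ?nnegrE ?(ltW e0)//.
    by case/andP: halpha => /ltW.
  exact: Ke.
rewrite /weight /M; case: ifP => _; last case: ifP => _.
- rewrite normrM ger0_norm ?powR_ge0// ler_pM ?powR_ge0// lerDl//.
- rewrite normrM ger0_norm ?powR_ge0// ler_pM ?powR_ge0// lerDr//.
- by rewrite normr0 mulr_ge0 ?powR_ge0 ?addr_ge0.
Qed.

Lemma Hardy_weight_weight : Hardy_weight k p (weight alpha k p s).
Proof.
split; first exact: locally_integrable_weight.
by move=> u hu; rewrite (integral_weight hu); exact: energy_ge.
Qed.

End lower_bound.

(** * Continuity of functions given in the coordinate [ln x] *)

Section continuity.
Context {R : realType}.
Implicit Types (f g : R -> R) (x y z L : R).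

Lemma lipschitz_continuous f (M : R) :
  (forall x y, `|f x - f y| <= M * `|x - y|) -> continuous f.
Proof.
move=> h x; apply/cvgrPdist_le => /= e e0.
have M0 : 0 < `|M| + 1 by rewrite ltr_wpDl.
near=> y; apply: (le_trans (h x y)).
apply: (@le_trans _ _ ((`|M| + 1) * `|x - y|)).
  by rewrite ler_wpM2r// (le_trans (ler_norm _))// lerDl.
rewrite -ler_pdivlMl//; near: y.
exists ((`|M| + 1)^-1 * e) => /=; first by rewrite mulr_gt0// invr_gt0.
by move=> t /= /ltW.
Unshelve. all: by end_near. Qed.

(** Near the origin [ln x] falls below [- L], where [g] vanishes, so the extension is locally 0. *)
Lemma continuous_log_extension g L : continuous g ->
  (forall z, L <= `|z| -> g z = 0) ->
  continuous (fun x => if 0 < x then g (ln x) else 0).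
Proof.
move=> cg g0 x; have [x0|x0] := ltP 0 x.
  have : g (ln y) @[y --> x] --> g (ln x).
    by apply: (cvg_comp (@ln R) g); [exact: continuous_ln|exact: cg].
  rewrite /continuous_at x0; apply: cvg_trans; apply: near_eq_cvg.
  near=> y; rewrite ifT//; near: y; exact: lt_nbhsr.
rewrite /continuous_at ltNge x0 /=; apply: cvg_near_cst; near=> y.
case: ifPn => // y0; apply: g0.
have : y < expR (- L).
  by near: y; apply: lt_nbhsl; rewrite (le_lt_trans x0)// expR_gt0.
rewrite -{1}(@lnK _ y) ?posrE// ltr_expR ltrNr => /ltW/le_trans; apply.
by rewrite -normrN ler_norm.
Unshelve. all: by end_near. Qed.

End continuity.

(** * The logarithmic cutoff and its increments *)

Section cutoff.
Context {R : realType} (N : R).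
Hypothesis N0 : 0 < N.
Local Notation mu := (@lebesgue_measure R).
Implicit Types (a z w : R).

Definition cutoff z : R := Num.max 0 (1 - `|z| / N).

Lemma cutoff_itv z : 0 <= cutoff z <= 1.
Proof.
rewrite /cutoff le_max lexx/= ge_max ler01/= lerBlDr lerDl.
by rewrite divr_ge0// ltW.
Qed.

Lemma cutoff_eq0 z : N <= `|z| -> cutoff z = 0.
Proof.
by move=> Nz; rewrite /cutoff max_l// subr_le0 ler_pdivlMr// mul1r.
Qed.

Lemma cutoff_gt0 z : `|z| < N -> 0 < cutoff z.
Proof.
by move=> zN; rewrite /cutoff lt_max subr_gt0 ltr_pdivrMr// mul1r zN orbT.
Qed.

Lemma cutoff_lipschitz z w : `|cutoff z - cutoff w| <= N^-1 * `|z - w|.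
Proof.
have max_lip (x y : R) : `|Num.max 0 x - Num.max 0 y| <= `|x - y|.
  have h1 := ler_norm (x - y); have := ler_norm (y - x); rewrite distrC => h2.
  rewrite ler_norml; case: (leP 0 x) => x0; case: (leP 0 y) => y0;
    apply/andP; split; lra.
apply: (le_trans (max_lip _ _)).
rewrite (_ : _ - _ = N^-1 * (`|w| - `|z|)); last by field; rewrite gt_eqF.
rewrite normrM gtr0_norm ?invr_gt0// ler_wpM2l ?invr_ge0 ?(ltW N0)//.
by rewrite distrC ler_dist_dist.
Qed.

(** The Lipschitz bound counts only if [z] or [z + a] lies in the window of length [2 * N].
    Integration over [z] thus gives [4 * N * (a / N)^2 = 4 * a^2 / N]. *)
Lemma cutoff_increment_le a z : (cutoff z - cutoff (z + a)) ^+ 2 <=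
  (a / N) ^+ 2 * (\1_`[- N, N] z + \1_`[- N, N] (z + a)).
Proof.
have h : (cutoff z - cutoff (z + a)) ^+ 2 <= (a / N) ^+ 2.
  rewrite -[leLHS]real_normK ?num_real// -[leRHS]real_normK ?num_real//.
  rewrite lerXn2r ?nnegrE//; apply: (le_trans (cutoff_lipschitz _ _)).
  by rewrite opprD addNKr normrN normrM mulrC normfV (gtr0_norm N0).
have out w : ~~ (w \in `[- N, N]) -> cutoff w = 0.
  by rewrite in_itv/= -ler_norml -ltNge => /ltW; exact: cutoff_eq0.
rewrite !indicE !mem_setE.
have [zi|/out z0] := boolP (z \in `[- N, N]);
  have [wi|/out w0] := boolP (z + a \in `[- N, N]).
- by rewrite (le_trans h)// mulrDr mulr1 lerDl sqr_ge0.
- by rewrite addr0 mulr1.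
- by rewrite add0r mulr1.
- by rewrite z0 w0 subrr expr0n/= addr0 mulr0.
Qed.

Let indic_translate a z :
  \1_`[- N, N] z + \1_`[- N, N] (z + a) =
  1 * \1_`[- N, N] z + 1 * \1_`[- N - a, N - a] z :> R.
Proof. by rewrite !mul1r !indicE !mem_setE !in_itv/= lerBlDr lerBrDr. Qed.

Let integrable_indic1 (c : R) : mu.-integrable setT (EFin \o \1_`[- N - c, N - c]).
Proof. exact: (integrable_indic_itv (- N - c) (N - c) true false). Qed.

Let integrable_indic0 : mu.-integrable setT (EFin \o \1_`[- N, N]).
Proof. exact: (integrable_indic_itv (- N) N true false). Qed.

Let Rintegral_indic (c d : R) : c < d -> (\int[mu]_z \1_`[c, d] z)%R = d - c.
Proof.
move=> cd; rewrite /Rintegral (integral_indic _ measurableT)//= setIT.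
by rewrite lebesgue_measure_itv/= lte_fin cd.
Qed.

Lemma integrable_cutoff_bound a : mu.-integrable setT
  (EFin \o (fun z => \1_`[- N, N] z + \1_`[- N, N] (z + a))).
Proof.
apply: eq_integrable (integrable_lincomb 1 1 integrable_indic0 (integrable_indic1 a)) => // z _ /=.
by rewrite indic_translate.
Qed.

Lemma integral_cutoff_bound a :
  (\int[mu]_z (\1_`[- N, N] z + \1_`[- N, N] (z + a)))%R = 4 * N.
Proof.
rewrite /Rintegral; under eq_integral do rewrite indic_translate.
rewrite (integral_lincomb _ _ integrable_indic0 (integrable_indic1 a)) /=.
have n1 : - N < N by apply: (lt_trans _ N0); rewrite oppr_lt0.
have n2 : - N - a < N - a by rewrite ltrD2r.
by rewrite (Rintegral_indic n1) (Rintegral_indic n2); ring.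
Qed.

Lemma continuous_cutoff_powR (r : R) : 1 < r -> continuous (fun z => cutoff z `^ r).
Proof.
move=> r1; apply: (@lipschitz_continuous _ _ (r * N^-1)) => x y.
apply: (le_trans (powR_lipschitz r1 (cutoff_itv x) (cutoff_itv y))).
rewrite -mulrA ler_wpM2l ?cutoff_lipschitz// (le_trans _ (ltW r1))//.
Qed.

End cutoff.

(** * The truncated ground state *)

Section ground_state.
Context {R : realType} (alpha p s : R).
Hypotheses (hp : 1 < p) (hs : 0 < s).
Local Notation beta := (alpha - 1).
Local Notation q := (conj_exp p).
Implicit Types (N x z a : R) (b d : bool).

Let p0 : 0 < p. Proof. by rewrite (lt_trans _ hp). Qed.
Let q0 : 0 < q. Proof. by rewrite (lt_trans _ (conj_exp_gt1 hp)). Qed.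

(* The ground state is [side_height b * `|x| `^ ((alpha - 1) / p)] on side [b]. *)
Definition side_height b : R := if b then 1 else s `^ p^-1.

Lemma side_height_gt0 b : 0 < side_height b.
Proof. by case: b; rewrite /side_height ?powR_gt0. Qed.

Lemma side_height_ratio b d : side_height b * pair_ratio p s b d = side_height d.
Proof.
rewrite /pair_ratio /side_ratio /side_height; case: b d => [] [] /=; rewrite ?mulr1 ?mul1r//.
by rewrite mulfV// gt_eqF// powR_gt0.
Qed.

Definition truncated_log N z : R := expR (beta / p * z) * cutoff N z `^ q.

Definition truncated_ground_state N x : R :=
  if 0 < x then side_height true * truncated_log N (ln x)
  else if x < 0 then side_height false * truncated_log N (ln (- x)) else 0.

Lemma truncated_ground_state_side N b z :
  truncated_ground_state N (side R b * expR z) = side_height b * truncated_log N z.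
Proof.
rewrite /truncated_ground_state; case: b; rewrite /side ?mul1r ?mulN1r.
  by rewrite expR_gt0 expRK.
by rewrite oppr_gt0 oppr_lt0 expR_gt0 ltNge expR_ge0/= opprK expRK.
Qed.

Lemma truncated_ground_state_Cc N : 0 < N -> Cc_punctured (truncated_ground_state N).
Proof.
move=> N0.
have cg : continuous (truncated_log N).
  move=> z; apply: cvgM; last exact: continuous_cutoff_powR (conj_exp_gt1 hp) _.
  apply: (cvg_comp (fun z => beta / p * z) expR); last exact: continuous_expR.
  by apply: cvgM; [exact: cvg_cst|exact: cvg_id].
have g0 z : N <= `|z| -> truncated_log N z = 0.
  by move=> Nz; rewrite /truncated_log cutoff_eq0// powR0 ?gt_eqF// mulr0.
pose v x := if 0 < x then truncated_log N (ln x) else 0.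
have cv : continuous v := continuous_log_extension cg g0.
have uE : truncated_ground_state N = (fun x => side_height true * v x + side_height false * v (- x)).
  apply/funext => x; rewrite /truncated_ground_state /v oppr_gt0.
  by case: (ltgtP x 0) => h; rewrite ?mulr0 ?addr0 ?add0r.
have v0 x : x < expR (- N) -> v x = 0.
  move=> xN; rewrite /v; case: ifPn => // x0; apply: g0.
  move: xN; rewrite -{1}(@lnK _ x) ?posrE// ltr_expR ltrNr => /ltW/le_trans; apply.
  by rewrite -normrN ler_norm.
have v1 x : expR N < x -> v x = 0.
  move=> xN; rewrite /v; case: ifPn => // x0; apply: g0.
  move: xN; rewrite -{1}(@lnK _ x) ?posrE// ltr_expR => /ltW/le_trans; apply.
  exact: ler_norm.
have near0 x : `|x| < expR (- N) -> truncated_ground_state N x = 0.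
  rewrite ltr_norml => /andP[h1 h2].
  by rewrite uE (v0 x)// (v0 (- x)) ?mulr0 ?addr0// ltrNl.
have far x : expR N < `|x| -> truncated_ground_state N x = 0.
  have e0 : 0 < expR N := expR_gt0 N.
  have [x0|x0] := ger0P x.
    by move=> h; rewrite uE (v1 _ h) /v oppr_gt0 ltNge x0/= !mulr0 addr0.
  by move=> h; rewrite uE (v1 _ h) /v ltNge (ltW x0)/= !mulr0 addr0.
split.
- rewrite uE => x; apply: cvgD; apply: cvgM; (try exact: cvg_cst); first exact: cv.
  apply: (cvg_comp (fun y => - y) v); last exact: cv.
  by apply: cvgN; exact: cvg_id.
- apply: (@subclosed_compact _ _ `[- expR N, expR N]%classic).
  + exact: closed_closure.
  + exact: segment_compact.
  + rewrite [X in _ `<=` X](closure_id _).1; last exact: itv_closed.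
    apply: closure_subset => x /= ux; rewrite in_itv/= -ler_norml leNgt.
    by apply: contra ux => /far ->.
- move=> x cx /= x0; rewrite {}x0 in cx.
  have /cx[y [/= uy]] : nbhs (0 : R) (ball 0 (expR (- N))).
    by apply: nbhsx_ballx; exact: expR_gt0.
  rewrite /ball/= sub0r normrN => /near0 y0.
  by rewrite y0 eqxx in uy.
Qed.

(** The error coefficient of [energy_gap_le] times the factor of [log_energy], after the dependence
    on [z] has cancelled. *)
Definition increment_weight b d a : R :=
  side_height b `^ p * (p * q) *
  (pair_ratio p s b d `^ (p - 1) * expR ((beta / q - beta / 2) * a) +
   pair_ratio p s b d * expR ((beta / p - beta / 2) * a)).

Lemma log_energy_truncated_le N b d a z : 0 < N ->
  log_energy alpha p (truncated_ground_state N) b d a z <=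
  log_mass alpha p (truncated_ground_state N) b z * ratio_weight alpha p (pair_ratio p s b d) a +
  log_mass alpha p (truncated_ground_state N) d (z + a) * ratio_weight alpha p (pair_ratio p s d b) (- a) +
  increment_weight b d a * (cutoff N z - cutoff N (z + a)) ^+ 2.
Proof.
move=> N0; set u := truncated_ground_state N.
have r0 := pair_ratio_gt0 p hs b d.
have l0 : 0 < pair_ratio p s b d * expR (beta / p * a) by rewrite mulr_gt0 ?expR_gt0.
have h0 : 0 < side_height b * expR (beta / p * z) by rewrite mulr_gt0 ?expR_gt0 ?side_height_gt0.
have := energy_gap_le hp l0 h0 (cutoff_itv N0 z) (cutoff_itv N0 (z + a)).
have -> : side_height b * expR (beta / p * z) * cutoff N z `^ q = u (side R b * expR z).
  by rewrite /u truncated_ground_state_side /truncated_log mulrA.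
have -> : side_height b * expR (beta / p * z) * (pair_ratio p s b d * expR (beta / p * a)) *
    cutoff N (z + a) `^ q = u (side R d * expR (z + a)).
  rewrite /u truncated_ground_state_side /truncated_log mulrA -(side_height_ratio b d).
  by rewrite mulrDr expRD; ring.
move=> /(ler_wpM2l (expR_ge0 (- beta * (z + a / 2)))) h.
apply: (le_trans h); rewrite mulrDr log_mass_ratio_weight lerD2l; apply: eq_ler.
rewrite /increment_weight powRM ?expR_ge0 ?(ltW (side_height_gt0 b))//.
rewrite (@powRM _ (pair_ratio p s b d)) ?expR_ge0 ?(ltW r0)// -!expRM.
have -> : expR (- beta * (z + a / 2)) = expR (- beta * z) * expR (- beta / 2 * a).
  by rewrite -expRD; congr expR; field.
have -> : beta / p * z * p = beta * z by field; rewrite gt_eqF.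
have -> : beta / p * a * (p - 1) = beta / q * a.
  by rewrite /conj_exp; field; rewrite subr_eq0 !gt_eqF.
have e t : (beta / t - beta / 2) * a = - beta / 2 * a + beta / t * a by ring.
rewrite !e !expRD.
(* Here the exponent [beta / p] matters: the [p]-th power of the ground state cancels the
   homogeneity factor in [z]. *)
have e1 : expR (- beta * z) * expR (beta * z) = 1 by rewrite -expRD mulNr addNr expR0.
transitivity ((expR (- beta * z) * expR (beta * z)) * (side_height b `^ p * (p * q) *
  (pair_ratio p s b d `^ (p - 1) * (expR (- beta / 2 * a) * expR (beta / q * a)) +
   pair_ratio p s b d * (expR (- beta / 2 * a) * expR (beta / p * a))) *
   (cutoff N z - cutoff N (z + a)) ^+ 2)); first by ring.
by rewrite e1 mul1r.
Qed.

End ground_state.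

(** * Energy of the truncated ground states *)

Section upper_bound.
Context {R : realType} (alpha p s : R) (k : R * R -> \bar R).
Hypotheses (halpha : 0 < alpha < 2) (hp : 1 < p) (hs : 0 < s).
Hypothesis hk : kernel_class alpha k.
Local Notation n := (log_kernel k).
Local Notation mu := (@lebesgue_measure R).
Local Notation q := (conj_exp p).
Local Notation u := (truncated_ground_state alpha p s).
Implicit Types (N x z a : R) (b d : bool).

Let p0 : 0 < p. Proof. by rewrite (lt_trans _ hp). Qed.
Let q0 : 0 < q. Proof. by rewrite (lt_trans _ (conj_exp_gt1 hp)). Qed.

Lemma increment_weight_ge0 b d a : 0 <= increment_weight alpha p s b d a.
Proof.
have h1 := side_height_gt0 p hs b; have h2 := pair_ratio_gt0 p hs b d.
apply: mulr_ge0; first by rewrite mulr_ge0 ?powR_ge0// mulr_ge0 ?(ltW p0) ?(ltW q0).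
by rewrite addr_ge0// mulr_ge0 ?powR_ge0 ?expR_ge0// ltW.
Qed.

Let excess b d a : R := 4 * increment_weight alpha p s b d a * a ^+ 2 * n b d a.

Let integrable_excess b d : mu.-integrable setT (EFin \o excess b d).
Proof.
have i1 := integrable_log_kernel_sqr halpha hk b d (norm_exponent alpha (conj_exp_gt1 hp)).
have i2 := integrable_log_kernel_sqr halpha hk b d (norm_exponent alpha hp).
pose c := 4 * (side_height p s b `^ p * (p * q)).
have := integrable_lincomb (c * pair_ratio p s b d `^ (p - 1)) (c * pair_ratio p s b d) i1 i2.
apply: eq_integrable => // a _ /=; congr EFin.
by rewrite /excess /increment_weight /c; ring.
Qed.

Lemma inner_log_energy_le N b d a : 0 < N ->
  (\int[mu]_z (log_energy alpha p (u N) b d a z * n b d a)%:E <=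
   (1 * (main_weight alpha p s (u N) b d a * n b d a) + N^-1 * excess b d a)%:E)%E.
Proof.
move=> N0; have hu := truncated_ground_state_Cc alpha s hp N0.
have n0 := log_kernel_ge0 hk b d a.
have := fun z => log_energy_truncated_le alpha hp hs b d a z N0.
rewrite /main_weight.
move: (ratio_weight _ _ _ a) (ratio_weight _ _ _ (- a)) => w1 w2 h.
(* Times the window integral [4 * N], this equals [N^-1 * excess b d a]. *)
pose K := increment_weight alpha p s b d a * (a / N) ^+ 2 * n b d a.
pose f z := log_mass alpha p (u N) b z * (w1 * n b d a) +
            log_mass alpha p (u N) d (z + a) * (w2 * n b d a).
pose g z := \1_`[- N, N] z + \1_`[- N, N] (z + a) : R.
have intf : mu.-integrable setT (EFin \o f).
  exact: (integrable_log_masses alpha hp hu b d a (w1 * n b d a) (w2 * n b d a)).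
have intg : mu.-integrable setT (EFin \o g) by exact: integrable_cutoff_bound.
have -> : 1 * ((mass alpha p (u N) b * w1 + mass alpha p (u N) d * w2) * n b d a) +
    N^-1 * excess b d a = 1 * (\int[mu]_z f z)%R + K * (\int[mu]_z g z)%R.
  rewrite integral_cutoff_bound// /Rintegral /f integral_log_masses//=.
  rewrite /K /excess; move: (mass _ _ _ b) (mass _ _ _ d) (increment_weight _ _ _ _ _ _).
  by move: (n b d a) => y m1 m2 v; field; rewrite gt_eqF.
rewrite -integral_lincomb//; apply: ge0_le_integral => //.
- by move=> z _; rewrite lee_fin mulr_ge0 ?log_energy_ge0.
- by apply/measurable_EFinP; apply: measurable_funM => //; exact: measurable_log_energy1.
- by have /integrableP[] := integrable_lincomb 1 K intf intg.
move=> z _; rewrite lee_fin.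
apply: (le_trans (ler_wpM2r n0 (h z))).
have := ler_wpM2l (increment_weight_ge0 b d a) (cutoff_increment_le N0 a z).
move=> /(ler_wpM2r n0); rewrite -(lerD2l (f z)) => h2.
apply: (le_trans (le_trans _ h2)); apply: eq_ler; rewrite /f /K /g.
  by move: (log_mass _ _ _ b z) (log_mass _ _ _ d _) (increment_weight _ _ _ _ _ _)
    (n b d a) (cutoff _ _) (cutoff _ _) => *; ring.
by move: (log_mass _ _ _ b z) (log_mass _ _ _ d _) (increment_weight _ _ _ _ _ _)
  (n b d a) (\1_ _ z + _) => *; ring.
Qed.

Lemma log_energy_integral_le N b d : 0 < N ->
  (log_energy_integral alpha p k (u N) b d <=
   (main_integral alpha p s k (u N) b d + N^-1 * (\int[mu]_a excess b d a)%R)%:E)%E.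
Proof.
move=> N0; have hu := truncated_ground_state_Cc alpha s hp N0.
have i1 := integrable_main_weight halpha hp hs hk (u N) b d.
have i2 := integrable_excess b d.
have -> : main_integral alpha p s k (u N) b d + N^-1 * (\int[mu]_a excess b d a)%R =
  1 * (\int[mu]_a (main_weight alpha p s (u N) b d a * n b d a))%R +
  N^-1 * (\int[mu]_a excess b d a)%R.
  by rewrite mul1r [X in _ = X + _]/Rintegral (integral_main_weight halpha hp hs hk (u N) b d).
rewrite -integral_lincomb//; apply: ge0_le_integral => //.
- by move=> a _; apply: integral_ge0 => z _; rewrite lee_fin mulr_ge0 ?log_energy_ge0 ?(log_kernel_ge0 hk).
- apply: (measurable_fun_fubini_tonelli_G (m1 := mu)
   (fun x : R * R => (log_energy alpha p (u N) b d x.2 x.1 * n b d x.2)%:E)).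
    apply/measurable_EFinP; apply: measurable_funM.
      by apply: measurable_log_energy; exact: Cc_punctured_measurable.
    by apply: (measurableT_comp (measurable_log_kernel hk b d)).
  by move=> x; rewrite lee_fin mulr_ge0 ?log_energy_ge0 ?(log_kernel_ge0 hk).
- by have /integrableP[] := integrable_lincomb 1 N^-1 i1 i2.
- by move=> a _; exact: inner_log_energy_le.
Qed.

Lemma energy_truncated_le : exists Q : R, forall N, 0 < N ->
  (energy k p (u N) <=
   \int[mu]_x (`|u N x| `^ p * weight alpha k p s x)%:E + (N^-1 * Q)%:E)%E.
Proof.
exists (2^-1 * ((\int[mu]_a excess true true a + \int[mu]_a excess true false a) +
  (\int[mu]_a excess false true a + \int[mu]_a excess false false a)))%R => N N0.
have hu := truncated_ground_state_Cc alpha s hp N0.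
rewrite (integral_weight alpha s k hp hu) -EFinD -(sum_main_integral s halpha hp hk).
rewrite (energy_log hp hk (Cc_punctured_measurable hu)).
have := fun b d => log_energy_integral_le b d N0.
set M := main_integral alpha p s k (u N) => h.
apply: (@le_trans _ _ ((2^-1)%:E *
  (((M true true + N^-1 * (\int[mu]_a excess true true a)%R)%:E +
    (M true false + N^-1 * (\int[mu]_a excess true false a)%R)%:E) +
   ((M false true + N^-1 * (\int[mu]_a excess false true a)%R)%:E +
    (M false false + N^-1 * (\int[mu]_a excess false false a)%R)%:E)))%E).
  by rewrite lee_wpmul2l ?lee_fin ?invr_ge0// !leeD.
by rewrite -!EFinD -EFinM lee_fin; apply: eq_ler; ring.
Qed.

End upper_bound.

(** * Criticality of the weight *)

Section criticality.
Context {R : realType} (alpha p s : R) (k : R * R -> \bar R).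
Hypotheses (halpha : 0 < alpha < 2) (hp : 1 < p) (hs : 0 < s).
Hypothesis hk : kernel_class alpha k.
Local Notation mu := (@lebesgue_measure R).
Local Notation u := (truncated_ground_state alpha p s).

Let p0 : 0 < p. Proof. by rewrite (lt_trans _ hp). Qed.

Lemma integrable_Cc_locally (v W : R -> R) : Cc_punctured v ->
  locally_integrable [set~ 0] W ->
  mu.-integrable setT (EFin \o (fun x => `|v x| `^ p * W x)).
Proof.
move=> hv [mW _ lW]; have [cv cK K0] := hv; set K := closure _ in cK K0.
have [B hB] := Cc_punctured_bounded hv.
have B0 : 0 <= B := le_trans (normr_ge0 _) (hB 0).
have vK x : ~ K x -> v x = 0.
  by move=> Kx; apply/eqP; apply: contra_notT Kx => vx; exact: subset_closure.
have mK : measurable K by exact: compact_measurable.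
have mW' : measurable_fun K W.
  by apply: (measurable_funS _ K0 mW); exact: measurableC.
have iW : mu.-integrable setT ((EFin \o W) \_ K).
  apply: ((integrable_mkcond (mu := mu) (EFin \o W) mK).1 _); apply/integrableP; split.
    exact/measurable_EFinP.
  by under eq_integral do rewrite /=; exact: lW.
have mvW : measurable_fun setT (EFin \o (fun x => `|v x| `^ p * W x)).
  (* Off [K] the function [v] vanishes, so [W], uncontrolled at the origin, may be set to 0
     there. *)
  rewrite (_ : EFin \o _ = (fun x => (`|v x| `^ p)%:E * ((EFin \o W) \_ K) x)%E).
    apply: emeasurable_funM; last by have /integrableP[] := iW.
    apply/measurable_EFinP; apply: (measurableT_comp (measurable_powR p)).
    by apply: measurableT_comp => //; exact: Cc_punctured_measurable.
  apply/funext => x /=; rewrite patchE; case: ifPn => [//|].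
  by rewrite notin_setE => /vK ->; rewrite normr0 powR0 ?gt_eqF// mul0r mule0.
apply: (le_integrable _ _ _ (integrableZl measurableT (B `^ p) iW)) => //= x _.
rewrite patchE; case: ifPn => [_|]; last first.
  by rewrite notin_setE => /vK ->; rewrite normr0 powR0 ?gt_eqF// mul0r normr0 mule0 abse0.
rewrite /= lee_fin !normrM ler_wpM2r// !(ger0_norm (powR_ge0 _ _)).
by rewrite ge0_ler_powR ?nnegrE// ltW.
Qed.

Lemma truncated_ground_state_ge0 N x : 0 < N -> 0 <= u N x.
Proof.
move=> N0; rewrite /truncated_ground_state /truncated_log.
by case: ifP => _; last case: ifP => _ //; rewrite !mulr_ge0 ?expR_ge0 ?powR_ge0// ltW ?side_height_gt0.
Qed.

Lemma le_truncated_ground_state N M x : 0 < N -> N <= M -> u N x <= u M x.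
Proof.
move=> N0 NM; have M0 := lt_le_trans N0 NM.
have q0 : 0 < conj_exp p by rewrite (lt_trans _ (conj_exp_gt1 hp)).
have h z : truncated_log alpha p N z <= truncated_log alpha p M z.
  rewrite /truncated_log ler_wpM2l ?expR_ge0//.
  have /andP[c0 _] := cutoff_itv N0 z; have /andP[c1 _] := cutoff_itv M0 z.
  rewrite ge0_ler_powR ?nnegrE ?(ltW q0)// /cutoff ge_max le_max lexx/=.
  by rewrite le_max lerD2l lerN2 ler_wpM2l ?lef_pV2 ?posrE ?orbT.
rewrite /truncated_ground_state.
by case: ifP => _; last case: ifP => _ //; rewrite ler_wpM2l ?h// ltW// side_height_gt0.
Qed.

Lemma truncated_ground_state_gt0 x : x != 0 -> exists m : nat, 0 < u m.+1%:R x.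
Proof.
move=> x0.
have [b [z ->]] : exists b z, x = side R b * expR z.
  have [x1|x1|x1] := ltgtP x 0; last by rewrite x1 eqxx in x0.
    by exists false, (ln (- x)); rewrite lnK ?posrE ?oppr_gt0// mulN1r opprK.
  by exists true, (ln x); rewrite lnK ?posrE// mul1r.
exists (Num.bound `|z|); rewrite truncated_ground_state_side mulr_gt0 ?side_height_gt0//.
rewrite /truncated_log mulr_gt0 ?expR_gt0// powR_gt0// cutoff_gt0//.
by apply: (lt_le_trans (archi_boundP (normr_ge0 z))); rewrite ler_nat.
Qed.

(** The functions [|f m|] increase with [m] while their integrals are at most [Q / (m + 1)]; hence
    every one of these integrals is 0, and at each [x != 0] some truncated ground state is
    positive. *)
Lemma weight_critical (W : R -> R) : Hardy_weight k p W ->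
  {ae mu, forall x, weight alpha k p s x <= W x} ->
  {ae mu, forall x, W x = weight alpha k p s x}.
Proof.
move=> [lW hW] wW; set w := weight alpha k p s in wW *.
have lw : locally_integrable [set~ 0] w by exact: locally_integrable_weight.
have F : Filter (nbhs (almost_everywhere mu)) := ae_filter_ringOfSetsType mu.
have [Q hQ] := energy_truncated_le halpha hp hs hk.
pose f (m : nat) x := `|u m.+1%:R x| `^ p * (W x - w x).
have N0 (m : nat) : 0 < m.+1%:R :> R by [].
have hu m := truncated_ground_state_Cc alpha s hp (N0 m).
have fE m x : f m x = 1 * (`|u m.+1%:R x| `^ p * W x) + -1 * (`|u m.+1%:R x| `^ p * w x).
  by rewrite /f; ring.
have iW m := integrable_Cc_locally (hu m) lW.
have iw m := integrable_Cc_locally (hu m) lw.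
have if_ m : mu.-integrable setT (EFin \o f m).
  by apply: eq_integrable (integrable_lincomb 1 (-1) (iW m) (iw m)) => // x _ /=; rewrite -fE.
have mf m : measurable_fun setT (EFin \o f m) by have /integrableP[] := if_ m.
have mfr m : measurable_fun setT (f m) by apply/measurable_EFinP; exact: mf.
have mabs m : measurable_fun setT (fun x => `|f m x|%:E).
  by apply/measurable_EFinP; exact: measurableT_comp.
have f_le m : (\int[mu]_x `|f m x|%:E <= (m.+1%:R^-1 * Q)%:E)%E.
  have -> : (\int[mu]_x `|f m x|%:E = \int[mu]_x (f m x)%:E)%E.
    apply: ae_eq_integral => //.
    - exact: mabs.
    - exact: mf.
    - move: wW; apply: filterS => x wx _ /=; rewrite ger0_norm// mulr_ge0 ?powR_ge0//.
      by rewrite subr_ge0.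
  under eq_integral do rewrite fE.
  rewrite (integral_lincomb _ _ (iW m) (iw m)).
  (* The energy of the truncated ground state lies between the integral with [W] and the one with
     [w] plus [Q / (m + 1)]. *)
  have := le_trans (hW _ (hu m)) (hQ _ (N0 m)).
  rewrite -(EFin_Rintegral (iW m)) -(EFin_Rintegral (iw m)) -EFinD !lee_fin.
  by rewrite mul1r mulN1r lerBlDl.
have f_mono m j x : (m <= j)%N -> `|f m x| <= `|f j x|.
  move=> mj; have mjR : m.+1%:R <= j.+1%:R :> R by rewrite ler_nat.
  have := le_truncated_ground_state x (N0 m) mjR.
  have := truncated_ground_state_ge0 x (N0 m); rewrite /f.
  move: (u m.+1%:R x) (u j.+1%:R x) (W x - w x) => y1 y2 d y10 y12.
  rewrite !normrM !(ger0_norm (powR_ge0 _ _)) ler_wpM2r//.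
  have y20 := le_trans y10 y12.
  by rewrite (ger0_norm y10) (ger0_norm y20) ge0_ler_powR ?nnegrE// ltW.
have fM m x : f m x = `|u m.+1%:R x| `^ p * (W x - w x) by [].
clearbody f; have f0 m : {ae mu, forall x, f m x = 0}.
  have : (\int[mu]_x `|(EFin \o f m) x| = 0)%E.
    apply/eqP; rewrite eq_le integral_ge0 ?andbT//.
    apply/lee_addgt0Pr => e e0; rewrite add0e.
    (* The index is at least [m] for monotonicity and large enough that [Q / (j + 1) <= e]. *)
    pose j := maxn m (Num.bound (`|Q| / e)).
    apply: (@le_trans _ _ (\int[mu]_x `|f j x|%:E)%E).
      change (\int[mu]_x `|f m x|%:E <= \int[mu]_x `|f j x|%:E)%E.
      apply: ge0_le_integral.
      - exact: measurableT.
      - by move=> x _; rewrite lee_fin.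
      - exact: mabs.
      - exact: mabs.
      - by move=> x _; rewrite lee_fin f_mono// leq_maxl.
    apply: (le_trans (f_le j)); rewrite lee_fin ler_pdivrMl//.
    rewrite (le_trans (ler_norm _))// mulrC -ler_pdivrMl// mulrC.
    have := archi_boundP (divr_ge0 (normr_ge0 Q) (ltW e0)) => /ltW/le_trans; apply.
    by rewrite ler_nat (leq_trans (leq_maxr m _)).
  move=> h; have := (ae_eq_integral_abs mu measurableT (mf m)).1 h.
  by apply: filterS => x /= /(_ I) [].
have := ae_foralln f0.
have : {ae mu, forall x : R, x != 0}.
  exists [set 0]; split => //; first exact: lebesgue_measure_set1.
  by move=> x /= /negP; rewrite negbK => /eqP.
apply: filterS2 => x x0 fx.
have [m um] := truncated_ground_state_gt0 x0.
have up : `|u m.+1%:R x| `^ p != 0 by rewrite gt_eqF// powR_gt0// normr_gt0 gt_eqF.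
by have /eqP := fx m; rewrite fM mulf_eq0 (negbTE up) subr_eq0 => /eqP.
Qed.

End criticality.

Theorem theorem3p3 (R : realType) (alpha p s : R) (k : R * R -> \bar R)
    (halpha : 0 < alpha < 2) (hp : 1 < p) (hs : 0 < s)
    (hk : kernel_class alpha k) :
  critical_Hardy_weight k p (weight alpha k p s).
Proof.
split; first exact: Hardy_weight_weight.
by move=> W hW; exact: weight_critical.
Qed.
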